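(* Let $k$ be an algebraically closed field, let $Q$ be a finite quiver without loops with vertices $1,\ldots,n$, and let $I\subset kQ$ be an admissible ideal generated by paths. Let $G$ be the canonical generating set of $I$ consisting of the minimal paths in $I$, and let $\pi^m_{ij}$ be the number of paths from $i$ to $j$ in the full subquiver $Q_{\leq m}$ on the vertices $1,\ldots,m$ which are not in $I$. Then the following are equivalent: (i) $kQ/I\text{-mod}$ is highest weight for the ordering $S_1,\ldots,S_n$ of its simple objects given by the vertices; (ii) $\pi^i_{ii}=1$ and $\pi^n_{im}=\sum_{j=1}^n\pi^j_{ij}\,\pi^j_{jm}$ for all $1\leq i,m\leq n$; (iii) all maximal vertices of each path in $G$ are external, i.e. no internal vertex of a path in $G$ is maximal in that path.
   Context: Paths: with $s,t\colon Q_1\to Q_0$ the source and target maps, a path of length $d$ is a concatenation $\alpha_1\cdots\alpha_d$ of arrows with $t(\alpha_l)=s(\alpha_{l+1})$ for $1\leq l\leq d-1$; it goes from $s(\alpha_1)$ to $t(\alpha_d)$. Trivial (length $0$) paths at vertices are included in the counts $\pi^m_{ij}$. The vertices $t(\alpha_1),\ldots,t(\alpha_{d-1})$ are called internal and $s(\alpha_1)$, $t(\alpha_d)$ external vertices of the path. A vertex $i$ in a path is maximal if $i\geq s(\alpha),t(\alpha)$ for all arrows $\alpha$ in the path. The set $G$ consists of the paths in $I$ none of whose proper subpaths lies in $I$. $kQ/I\text{-mod}$ is the category $\mathcal{A}$ of finite-dimensional modules over the finite-dimensional monomial algebra $kQ/I$, with conventions such that the projective cover $P_i$ of the simple module $S_i$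 at vertex $i$ has Jordan--Hölder multiplicity $[P_i:S_m]$ equal to the number of paths from $i$ to $m$ not in $I$. Highest weight: $\mathrm{Filt}(\ldots)$ denotes the extension-closure of a collection of objects (the objects with a finite filtration whose factors are isomorphic to members of the collection). Let $\mathcal{A}_i=\mathrm{Filt}(S_1,\ldots,S_i)$ and let the standard object $\Delta_i$ be the maximal quotient of $P_i$ lying in $\mathcal{A}_i$. Then $\mathcal{A}$ is highest weight for the ordering $S_1,\ldots,S_n$ if $\mathrm{End}_{\mathcal{A}}(\Delta_i)\cong k$ and $P_i\in\mathrm{Filt}(\Delta_i,\ldots,\Delta_n)$ for each $i=1,\ldots,n$. *)

(* Defs.v *)
From HB Require Import structures.
From mathcomp Require Import all_boot all_order all_algebra.
From mathcomp Require Import generic_quotient ring_quotient.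
From mathcomp Require Import finmap.
From mathcomp Require Import boolp classical_sets functions cardinality.
From mathcomp.multinomials Require Import monalg.

Set Implicit Arguments.
Unset Strict Implicit.
Unset Printing Implicit Defensive.

Import GRing.Theory.

Local Open Scope ring_scope.
Local Open Scope quotient_scope.

(* By [boolp], boolean predicates are no less general than subsets of [R]. *)
Record ideal (R : pzRingType) := Ideal {
  ideal_zmod :> zmodClosed R;
  idealMl : forall a x : R, x \in ideal_zmod -> a * x \in ideal_zmod;
  idealMr : forall a x : R, x \in ideal_zmod -> x * a \in ideal_zmod
}.

Section Ideals.
Variable R : pzRingType.

Definition ideal_gen (X : set R) : set R := fun x =>
  forall K : ideal R, (forall y, X y -> y \in K) -> x \in K.

Definition ideal_pow (J : set R) (m : nat) : set R := fun x =>
  exists s : seq (m.-tuple R),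
    (forall t, t \in s -> forall y, y \in t -> J y) /\
    x = \sum_(t <- s) \prod_(y <- t) y.

End Ideals.

(* The library has the additive group [{ideal_quot I}], but it gives it a ring
   structure only over commutative rings. *)
Definition quot_ring (R : pzRingType) (I : ideal R) : Type := {ideal_quot I}.

Section QuotRing.
Variables (R : pzRingType) (I : ideal R).

HB.instance Definition _ := GRing.Zmodule.on (quot_ring I).

Definition quot_pi (x : R) : quot_ring I := \pi_({ideal_quot I}) x.
Definition quot_repr (q : quot_ring I) : R := repr (q : {ideal_quot I}).

Lemma quot_reprK : cancel quot_repr quot_pi.
Proof. by move=> q; rewrite /quot_pi /quot_repr reprK. Qed.

Lemma quot_piP (x y : R) : quot_pi x = quot_pi y <-> x - y \in I.
Proof.
rewrite /quot_pi; split=> [e|]; first by rewrite Quotient.idealrBE e.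
by rewrite Quotient.idealrBE => /eqP.
Qed.

Lemma quot_reprP (x : R) : quot_repr (quot_pi x) - x \in I.
Proof. by apply/quot_piP; rewrite quot_reprK. Qed.

Lemma quot_piD : {morph quot_pi : x y / x + y}.
Proof. exact: Quotient.pi_add. Qed.

Definition quot_one : quot_ring I := quot_pi 1.
Definition quot_mul (p q : quot_ring I) : quot_ring I :=
  quot_pi (quot_repr p * quot_repr q).

Lemma quot_piM (x y : R) : quot_pi (x * y) = quot_mul (quot_pi x) (quot_pi y).
Proof.
apply/esym/quot_piP; set x' := quot_repr _; set y' := quot_repr _.
have -> : x' * y' - x * y = (x' - x) * y' + x * (y' - y).
  by rewrite mulrBl mulrBr addrA subrK.
apply: rpredD; [apply: idealMr|apply: idealMl]; exact: quot_reprP.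
Qed.

Lemma quot_mulA : associative quot_mul.
Proof.
move=> p q r; rewrite -[p]quot_reprK -[q]quot_reprK -[r]quot_reprK.
by rewrite -!quot_piM mulrA.
Qed.

Lemma quot_mul1 : left_id quot_one quot_mul.
Proof. by move=> p; rewrite -[p]quot_reprK -quot_piM mul1r. Qed.

Lemma quot_mulr1 : right_id quot_one quot_mul.
Proof. by move=> p; rewrite -[p]quot_reprK -quot_piM mulr1. Qed.

Lemma quot_mulDl : left_distributive quot_mul +%R.
Proof.
move=> p q r; rewrite -[p]quot_reprK -[q]quot_reprK -[r]quot_reprK.
by rewrite -quot_piD -!quot_piM -quot_piD mulrDl.
Qed.

Lemma quot_mulDr : right_distributive quot_mul +%R.
Proof.
move=> p q r; rewrite -[p]quot_reprK -[q]quot_reprK -[r]quot_reprK.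
by rewrite -quot_piD -!quot_piM -quot_piD mulrDr.
Qed.

HB.instance Definition _ := GRing.Zmodule_isPzRing.Build (quot_ring I)
  quot_mulA quot_mul1 quot_mulr1 quot_mulDl quot_mulDr.

Lemma quot_pi_is_zmod_morphism : zmod_morphism quot_pi.
Proof.
move=> x y; rewrite quot_piD; congr (_ + _).
exact: (@Quotient.pi_opp _ I).
Qed.

Lemma quot_pi_is_monoid_morphism : monoid_morphism quot_pi.
Proof. by split=> // x y; rewrite quot_piM. Qed.

HB.instance Definition _ :=
  GRing.isZmodMorphism.Build R (quot_ring I) quot_pi quot_pi_is_zmod_morphism.
HB.instance Definition _ :=
  GRing.isMonoidMorphism.Build R (quot_ring I) quot_pi
    quot_pi_is_monoid_morphism.

End QuotRing.

(* The vertex [i : 'I_n] stands for the vertex [i.+1] of {1, ..., n}. *)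
Record quiver (n : nat) := Quiver {
  arrow : finType;
  src : arrow -> 'I_n;
  tgt : arrow -> 'I_n
}.
Arguments src {n q} _.
Arguments tgt {n q} _.

Section Paths.
Variables (n : nat) (Q : quiver n).

Fixpoint composable (i : 'I_n) (w : seq (arrow Q)) : bool :=
  if w is a :: w' then (src a == i) && composable (tgt a) w' else true.

(* A path is its source with its sequence of arrows, so that there is a trivial
   path at each vertex. *)
Record qpath := QPath {
  qpath_val : 'I_n * seq (arrow Q);
  qpathP : composable qpath_val.1 qpath_val.2
}.

HB.instance Definition _ := [isSub for qpath_val].
HB.instance Definition _ := [Choice of qpath by <:].

Definition psrc (p : qpath) : 'I_n := (qpath_val p).1.
Definition parrows (p : qpath) : seq (arrow Q) := (qpath_val p).2.
Definition ptgt (p : qpath) : 'I_n := last (psrc p) (map tgt (parrows p)).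
Definition pvertices (p : qpath) : seq 'I_n := psrc p :: map tgt (parrows p).

Definition ptrivial (i : 'I_n) : qpath := @QPath (i, [::]) isT.

Lemma composable1 (a : arrow Q) : composable (src a) [:: a].
Proof. by rewrite /= eqxx. Qed.
Definition parrow (a : arrow Q) : qpath := @QPath (src a, [:: a]) (composable1 a).

Lemma composable_cat i w1 w2 :
  composable i (w1 ++ w2) =
  composable i w1 && composable (last i (map tgt w1)) w2.
Proof. by elim: w1 i => //= a w1 IH i; rewrite IH andbA. Qed.

Lemma pcat_subproof (p q : qpath) : ptgt p = psrc q ->
  composable (psrc p) (parrows p ++ parrows q).
Proof.
move=> e; rewrite composable_cat -/(ptgt p) e.
by rewrite (qpathP p) (qpathP q).
Qed.

Definition pcat (p q : qpath) (e : ptgt p = psrc q) : qpath :=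
  @QPath (psrc p, parrows p ++ parrows q) (pcat_subproof e).

Definition pconcat (p q : qpath) : option qpath :=
  if ptgt p =P psrc q is ReflectT e then Some (pcat e) else None.

Lemma pconcat_some p q r : pconcat p q = Some r <->
  [/\ ptgt p = psrc q, psrc r = psrc p & parrows r = parrows p ++ parrows q].
Proof.
rewrite /pconcat; case: eqP => [e|ne]; split=> //; last by case.
  by case=> <-.
case=> _ e1 e2; congr Some; apply/val_inj; rewrite /= -e1 -e2.
by rewrite /psrc /parrows -surjective_pairing.
Qed.

Lemma ptgt_concat p q r : pconcat p q = Some r -> ptgt r = ptgt q.
Proof.
case/pconcat_some => e1 e2 e3.
by rewrite /ptgt e2 e3 map_cat last_cat -/(ptgt p) e1.
Qed.

Lemma pconcatA p q r :
  obind (pconcat^~ r) (pconcat p q) = obind (pconcat p) (pconcat q r).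
Proof.
case epq: (pconcat p q) => [x|]; case eqr: (pconcat q r) => [y|] //=.
- have tx := ptgt_concat epq.
  case/pconcat_some: (epq) => a1 a2 a3; case/pconcat_some: (eqr) => b1 b2 b3.
  have /pconcat_some e : [/\ ptgt x = psrc r, psrc (@pcat x r (etrans tx b1)) = psrc x
    & parrows (pcat (etrans tx b1)) = parrows x ++ parrows r] by split=> //; rewrite tx.
  rewrite e; apply/esym/pconcat_some; split; rewrite ?b2 //.
  by rewrite /parrows /= -!/(parrows _) a3 b3 catA.
- have tx := ptgt_concat epq.
  case exr: (pconcat x r) => [z|] //; case/pconcat_some: exr => a _ _.
  by move: eqr; rewrite /pconcat; case: eqP => // ne; case: ne; rewrite -tx.
- case epy: (pconcat p y) => [z|] //; case/pconcat_some: epy => a _ _.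
  case/pconcat_some: eqr => _ b _; move: epq; rewrite /pconcat.
  by case: eqP => // ne; case: ne; rewrite a.
Qed.

Lemma pconcat1p i p : pconcat (ptrivial i) p = if i == psrc p then Some p else None.
Proof.
case: eqP => [->|ne]; first by apply/pconcat_some.
by rewrite /pconcat; case: eqP.
Qed.

Lemma pconcatp1 p i : pconcat p (ptrivial i) = if ptgt p == i then Some p else None.
Proof.
case: eqP => [<-|ne]; first by apply/pconcat_some; rewrite cats0.
by rewrite /pconcat; case: eqP.
Qed.

Definition subpath (q p : qpath) : Prop :=
  exists u v : seq (arrow Q),
    parrows p = u ++ parrows q ++ v /\ psrc q = last (psrc p) (map tgt u).

(* t(alpha_1), ..., t(alpha_(d-1)) for the path alpha_1 ... alpha_d *)
Definition internal (p : qpath) : seq 'I_n :=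
  map tgt (take (size (parrows p)).-1 (parrows p)).

Definition maximal_vertex (p : qpath) (i : 'I_n) : Prop :=
  i \in pvertices p /\
  forall a, a \in parrows p -> (src a <= i)%N && (tgt a <= i)%N.

(* [p] lies in the full subquiver on the vertices 1, ..., m, which are the
   ordinals less than [m]. *)
Definition path_within (m : nat) (p : qpath) : bool :=
  all (fun v : 'I_n => (v < m)%N) (pvertices p).

End Paths.
Arguments ptrivial {n Q} i.

Definition path_alg (k : fieldType) (n : nat) (Q : quiver n) : Type :=
  {malg k[qpath Q]}.

HB.instance Definition _ (k : fieldType) (n : nat) (Q : quiver n) :=
  GRing.Zmodule.on (path_alg k Q).

(* The operations are locked, because unification diverges when it unfolds
   those of [malg]. *)
HB.lock Definition path_scale (k : fieldType) (n : nat) (Q : quiver n)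
  (c : k) (x : path_alg k Q) : path_alg k Q := (c *: (x : {malg k[qpath Q]})).

Section PathAlgebraLmodule.
Variables (k : fieldType) (n : nat) (Q : quiver n).
Local Notation kQ := (path_alg k Q).

Lemma path_scaleA b c (x : kQ) :
  path_scale b (path_scale c x) = path_scale (b * c) x.
Proof. rewrite unlock; exact: (@scalerA k {malg k[qpath Q]}). Qed.

Lemma path_scale1 : left_id 1 (@path_scale k n Q).
Proof. rewrite unlock; exact: (@scale1r k {malg k[qpath Q]}). Qed.

Lemma path_scaleDr : right_distributive (@path_scale k n Q) +%R.
Proof. rewrite unlock => c; exact: (@scalerDr k {malg k[qpath Q]} c). Qed.

Lemma path_scaleDl (x : kQ) : {morph (@path_scale k n Q)^~ x : b c / b + c}.
Proof. rewrite unlock => b c; exact: (@scalerDl k {malg k[qpath Q]} x b c). Qed.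

HB.instance Definition _ := GRing.Zmodule_isLmodule.Build k kQ
  path_scaleA path_scale1 path_scaleDr path_scaleDl.

End PathAlgebraLmodule.

HB.lock Definition of_path (k : fieldType) (n : nat) (Q : quiver n)
  (p : qpath Q) : path_alg k Q := << p >>.
HB.lock Definition path_coef (k : fieldType) (n : nat) (Q : quiver n)
  (p : qpath Q) (x : path_alg k Q) : k := mcoeff p x.

Definition path_mul (k : fieldType) (n : nat) (Q : quiver n)
  (p q : qpath Q) : path_alg k Q := oapp (@of_path k n Q) 0 (pconcat p q).

Definition alg_one (k : fieldType) (n : nat) (Q : quiver n) : path_alg k Q :=
  \sum_(i < n) of_path k (ptrivial i).

HB.lock Definition alg_mul (k : fieldType) (n : nat) (Q : quiver n)
  (x y : path_alg k Q) : path_alg k Q :=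
  \sum_(p <- msupp x) \sum_(q <- msupp y)
    (path_coef p x * path_coef q y) *: path_mul k p q.

Section PathAlgebraRing.
Variables (k : fieldType) (n : nat) (Q : quiver n).
Local Notation kQ := (path_alg k Q).
Implicit Types (x y z : kQ) (p q r : qpath Q).

Lemma path_algP x y : (forall p, path_coef p x = path_coef p y) -> x = y.
Proof. by rewrite unlock => e; apply/malgP. Qed.

Lemma path_coefD p : {morph @path_coef k n Q p : x y / x + y}.
Proof. rewrite unlock; exact: mcoeffD. Qed.

Lemma path_coefZ p c x : path_coef p (c *: x) = c * path_coef p x.
Proof.
by rewrite -[c *: x]/(path_scale c x) !unlock; exact: mcoeffZ.
Qed.

Lemma msupp_scale c x : (msupp (c *: x) `<=` msupp x)%fset.
Proof. by rewrite -[c *: x]/(path_scale c x) unlock; exact: msuppZ_le. Qed.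

Lemma path_coefE p q : path_coef q (of_path k p) = (p == q)%:R.
Proof. rewrite !unlock; exact: mcoeffU. Qed.

Lemma path_coef0 p : path_coef p (0 : kQ) = 0.
Proof. rewrite unlock; exact: mcoeff0. Qed.

Lemma path_coef_outdom p x : p \notin msupp x -> path_coef p x = 0.
Proof. rewrite unlock; exact: mcoeff_outdom. Qed.

Lemma path_coef_sum p (J : Type) (s : seq J) (P : pred J) (F : J -> kQ) :
  path_coef p (\sum_(j <- s | P j) F j) = \sum_(j <- s | P j) path_coef p (F j).
Proof. exact: (big_morph _ (path_coefD p) (path_coef0 p)). Qed.

Lemma msupp_path p : msupp (of_path k p) = [fset p]%fset.
Proof. by rewrite [of_path]unlock msuppU oner_eq0. Qed.

Lemma path_algE x : x = \sum_(p <- msupp x) path_coef p x *: of_path k p.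
Proof.
rewrite {1}[x]monalgE; apply: eq_bigr => p _; apply: path_algP => q.
rewrite path_coefZ path_coefE mulr_natr unlock; exact: mcoeffU.
Qed.

Lemma alg_mulEw (d1 d2 : {fset qpath Q}) x y :
  (msupp x `<=` d1)%fset -> (msupp y `<=` d2)%fset ->
  alg_mul x y = \sum_(p <- d1) \sum_(q <- d2)
    (path_coef p x * path_coef q y) *: path_mul k p q.
Proof.
move=> le1 le2; rewrite unlock (big_fset_incl _ le1) /=.
  apply/eq_bigr=> p _; apply/big_fset_incl => // q _ /path_coef_outdom ->.
  by rewrite mulr0 scale0r.
move=> p _ /path_coef_outdom e; rewrite big1 // => q _.
by rewrite e mul0r scale0r.
Qed.

Lemma alg_mulDl : left_distributive (@alg_mul k n Q) +%R.
Proof.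
move=> x y z.
rewrite (alg_mulEw (msuppD_le x y) (fsubset_refl (msupp z))).
rewrite (alg_mulEw (fsubsetUl (msupp x) (msupp y)) (fsubset_refl (msupp z))).
rewrite (alg_mulEw (fsubsetUr (msupp x) (msupp y)) (fsubset_refl (msupp z))).
rewrite -big_split; apply: eq_bigr => p _; rewrite -big_split.
by apply: eq_bigr => q _; rewrite path_coefD mulrDl scalerDl.
Qed.

Lemma alg_mulDr : right_distributive (@alg_mul k n Q) +%R.
Proof.
move=> z x y.
rewrite (alg_mulEw (fsubset_refl (msupp z)) (msuppD_le x y)).
rewrite (alg_mulEw (fsubset_refl (msupp z)) (fsubsetUl (msupp x) (msupp y))).
rewrite (alg_mulEw (fsubset_refl (msupp z)) (fsubsetUr (msupp x) (msupp y))).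
rewrite -big_split; apply: eq_bigr => p _; rewrite -big_split.
by apply: eq_bigr => q _; rewrite path_coefD mulrDr scalerDl.
Qed.

Lemma alg_mul0x : left_zero (0 : kQ) (@alg_mul k n Q).
Proof. by move=> x; rewrite unlock msupp0 big_seq_fset0. Qed.

Lemma alg_mulx0 : right_zero (0 : kQ) (@alg_mul k n Q).
Proof. by move=> x; rewrite unlock big1 // => p _; rewrite msupp0 big_seq_fset0. Qed.

Lemma alg_mul_suml (J : Type) (s : seq J) (P : pred J) (F : J -> kQ) x :
  alg_mul (\sum_(j <- s | P j) F j) x = \sum_(j <- s | P j) alg_mul (F j) x.
Proof. exact: (big_morph (@alg_mul k n Q ^~ x) (fun y z => alg_mulDl y z x) (alg_mul0x x)). Qed.

Lemma alg_mul_sumr (J : Type) (s : seq J) (P : pred J) (F : J -> kQ) x :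
  alg_mul x (\sum_(j <- s | P j) F j) = \sum_(j <- s | P j) alg_mul x (F j).
Proof. exact: (big_morph (@alg_mul k n Q x) (alg_mulDr x) (alg_mulx0 x)). Qed.

Lemma alg_mulZl c x y : alg_mul (c *: x) y = c *: alg_mul x y.
Proof.
rewrite (alg_mulEw (msupp_scale c x) (fsubset_refl (msupp y))).
rewrite (alg_mulEw (fsubset_refl (msupp x)) (fsubset_refl (msupp y))) scaler_sumr.
apply: eq_bigr => p _; rewrite scaler_sumr; apply: eq_bigr => q _.
by rewrite path_coefZ scalerA mulrA.
Qed.

Lemma alg_mulZr c x y : alg_mul x (c *: y) = c *: alg_mul x y.
Proof.
rewrite (alg_mulEw (fsubset_refl (msupp x)) (msupp_scale c y)).
rewrite (alg_mulEw (fsubset_refl (msupp x)) (fsubset_refl (msupp y))) scaler_sumr.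
apply: eq_bigr => p _; rewrite scaler_sumr; apply: eq_bigr => q _.
by rewrite path_coefZ scalerA mulrCA.
Qed.

Lemma alg_mul_path p q : alg_mul (of_path k p) (of_path k q) = path_mul k p q.
Proof.
by rewrite unlock !msupp_path !big_seq_fset1 !path_coefE !eqxx mulr1 scale1r.
Qed.

Lemma path_mulA p q r :
  alg_mul (path_mul k p q) (of_path k r) = alg_mul (of_path k p) (path_mul k q r).
Proof.
have := pconcatA p q r; rewrite /path_mul.
case: (pconcat p q) => [u|]; case: (pconcat q r) => [v|] //= e;
  by rewrite ?alg_mul_path ?alg_mul0x ?alg_mulx0 /path_mul ?e // -?e.
Qed.

Lemma alg_mulA : associative (@alg_mul k n Q).
Proof.
move=> x y z; rewrite [x]path_algE [y]path_algE [z]path_algE.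
rewrite !alg_mul_suml; apply: eq_bigr => p _.
rewrite !alg_mul_sumr.
under [RHS]eq_bigr do rewrite alg_mul_suml.
rewrite [RHS]exchange_big; apply: eq_bigr => q _; rewrite !alg_mul_sumr.
apply: eq_bigr => r _.
rewrite !(alg_mulZl, alg_mulZr) !alg_mul_path path_mulA !scalerA.
by rewrite mulrC mulrA.
Qed.

Lemma alg_mul1 : left_id (alg_one k Q) (@alg_mul k n Q).
Proof.
move=> x; rewrite [x]path_algE alg_mul_sumr; apply: eq_bigr => p _.
rewrite alg_mulZr; congr (_ *: _); rewrite alg_mul_suml (bigD1 (psrc p)) //=.
rewrite alg_mul_path /path_mul pconcat1p eqxx big1 ?addr0 // => i ne.
by rewrite alg_mul_path /path_mul pconcat1p (negbTE ne).
Qed.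

Lemma alg_mulr1 : right_id (alg_one k Q) (@alg_mul k n Q).
Proof.
move=> x; rewrite [x]path_algE alg_mul_suml; apply: eq_bigr => p _.
rewrite alg_mulZl; congr (_ *: _); rewrite alg_mul_sumr (bigD1 (ptgt p)) //=.
rewrite alg_mul_path /path_mul pconcatp1 eqxx big1 ?addr0 // => i ne.
by rewrite alg_mul_path /path_mul pconcatp1 eq_sym (negbTE ne).
Qed.

HB.instance Definition _ := GRing.Zmodule_isPzRing.Build kQ
  alg_mulA alg_mul1 alg_mulr1 alg_mulDl alg_mulDr.

Definition path_alg_scalar (c : k) : kQ := c *: (1 : kQ).

Lemma path_alg_scalar_is_zmod_morphism : zmod_morphism path_alg_scalar.
Proof. by move=> b c; rewrite /path_alg_scalar scalerBl. Qed.

Lemma path_alg_scalar_is_monoid_morphism : monoid_morphism path_alg_scalar.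
Proof.
split=> [|b c]; rewrite /path_alg_scalar ?scale1r //.
by rewrite -[RHS]/(alg_mul _ _) alg_mulZl alg_mulZr alg_mul1 scalerA.
Qed.

HB.instance Definition _ := GRing.isZmodMorphism.Build k kQ path_alg_scalar
  path_alg_scalar_is_zmod_morphism.
HB.instance Definition _ := GRing.isMonoidMorphism.Build k kQ path_alg_scalar
  path_alg_scalar_is_monoid_morphism.

Lemma path_coef_trivialM i x y :
  path_coef (ptrivial i) (x * y) =
  path_coef (ptrivial i) x * path_coef (ptrivial i) y.
Proof.
rewrite -[x * y]/(alg_mul x y).
rewrite {1}[x]path_algE {1}[y]path_algE.
have triv p q : path_coef (ptrivial i) (path_mul k p q) =
    (p == ptrivial i)%:R * (q == ptrivial i)%:R.
  rewrite /path_mul; case e: (pconcat p q) => [r|] /=; last first.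
    rewrite path_coef0; case: eqP => [ep|]; last by rewrite mul0r.
    case: eqP => [eq|]; last by rewrite mulr0.
    by move: e; rewrite ep eq pconcat1p eqxx.
  rewrite path_coefE -natrM mulnb; congr (_%:R); congr nat_of_bool.
  apply/eqP/andP => [er|[/eqP ep /eqP eq]].
    case/pconcat_some: e => e1; rewrite er => e2 e3.
    have [ep eq] : parrows p = [::] /\ parrows q = [::].
      by move: e3; rewrite /parrows /=; case: (qpath_val p).2; case: (qpath_val q).2.
    have ep' : p = ptrivial i.
      apply: val_inj; rewrite /= [qpath_val p]surjective_pairing.
      by rewrite -/(psrc p) -/(parrows p) ep -e2.
    split; first by rewrite ep'.
    apply/eqP/val_inj; rewrite /= [qpath_val q]surjective_pairing.
    by rewrite -/(psrc q) -/(parrows q) eq -e1 ep'.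
  by move: e; rewrite ep eq pconcat1p eqxx => -[].
have coefE z : path_coef (ptrivial i) z =
    \sum_(p <- msupp z) path_coef p z * (p == ptrivial i)%:R.
  rewrite {1}[z]path_algE path_coef_sum; apply: eq_bigr => p _.
  by rewrite path_coefZ path_coefE.
rewrite (coefE x) (coefE y) mulr_suml alg_mul_suml path_coef_sum.
apply: eq_bigr => p _; rewrite alg_mul_sumr path_coef_sum mulr_sumr.
apply: eq_bigr => q _.
rewrite alg_mulZl alg_mulZr alg_mul_path !path_coefZ triv.
by rewrite -!mulrA; congr (_ * _); rewrite mulrCA.
Qed.

Lemma path_coef_trivial1 i : path_coef (ptrivial i) (1 : kQ) = 1.
Proof.
rewrite -[1]/(alg_one k Q) /alg_one path_coef_sum (bigD1 i) //=.
rewrite path_coefE eqxx big1 ?addr0 // => j ne.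
by rewrite path_coefE; case: eqP => // -[] /eqP; rewrite (negbTE ne).
Qed.

End PathAlgebraRing.

Section BoundQuiver.
Variables (k : fieldType) (n : nat) (Q : quiver n).
Local Notation kQ := (path_alg k Q).

Definition arrow_ideal : set kQ :=
  ideal_gen (fun x => exists a : arrow Q, x = of_path k (parrow a)).

Definition admissible (I : ideal kQ) : Prop :=
  exists N : nat, [/\ (2 <= N)%N,
    forall x, ideal_pow arrow_ideal N x -> x \in I &
    forall x, x \in I -> ideal_pow arrow_ideal 2 x].

Definition generated_by_paths (I : ideal kQ) : Prop :=
  exists X : set (qpath Q), forall x,
    x \in I <-> ideal_gen (fun y => exists2 p, X p & y = of_path k p) x.

Definition bound_scalar (I : ideal kQ) (c : k) : quot_ring I :=
  quot_pi I (path_alg_scalar Q c).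

HB.instance Definition _ (I : ideal kQ) :=
  GRing.RMorphism.copy (bound_scalar I) (quot_pi I \o @path_alg_scalar k n Q).

Definition minimal_path (I : ideal kQ) (p : qpath Q) : Prop :=
  of_path k p \in I /\
  forall q, subpath q p -> q <> p -> of_path k q \notin I.

(* pi^m_ij; the set is finite as soon as [I] is admissible. *)
Definition num_paths (I : ideal kQ) (m : nat) (i j : 'I_n) : nat :=
  #|` fset_set (fun p : qpath Q =>
       [/\ path_within m p, psrc p = i, ptgt p = j & of_path k p \notin I]) |.

Lemma admissible_trivial0 (I : ideal kQ) i x :
  admissible I -> x \in I -> path_coef (ptrivial i) x = 0.
Proof.
case=> N [_ _ I2] /I2 [s [sJ ->]].
pose K : {pred kQ} := [pred y | path_coef (ptrivial i) y == 0].
have KB : zmod_closed K.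
  split=> [|y z]; rewrite !inE ?path_coef0 // => /eqP ey /eqP ez.
  by rewrite path_coefD -scaleN1r path_coefZ ey ez mulr0 addr0.
pose Kz : zmodClosed kQ := HB.pack (K : _ -> bool) (GRing.isZmodClosed.Build kQ K KB).
have Kl a y : y \in Kz -> a * y \in Kz.
  by rewrite !inE path_coef_trivialM => /eqP ->; rewrite mulr0.
have Kr a y : y \in Kz -> y * a \in Kz.
  by rewrite !inE path_coef_trivialM => /eqP ->; rewrite mul0r.
have JK y : arrow_ideal y -> path_coef (ptrivial i) y = 0.
  move=> /(_ (Ideal Kl Kr)) /= JK; apply/eqP; apply: JK => _ [a ->].
  by rewrite inE path_coefE; case: (parrow a =P _) => // -[].
rewrite path_coef_sum big_seq big1 // => t ts.
have: all (fun y => path_coef (ptrivial i) y == 0) t.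
  by apply/allP => y /(sJ _ ts) /JK /eqP.
case/tupleP: t {ts} => y t /= /andP[/eqP y0 _].
by rewrite big_cons path_coef_trivialM y0 mul0r.
Qed.

End BoundQuiver.

(* Right [R]-modules are left modules over the converse ring [R^c].  As paths
   are multiplied by concatenation, it is for right modules over [kQ/I] that the
   projective cover of [S_i] has a basis given by the paths from [i] not in [I].
   The morphism [eta] is the [k]-algebra structure of [R]. *)
Section FdModules.
Variables (k : fieldType) (R : pzRingType) (eta : {rmorphism k -> R}).

Definition ract (M : lmodType R^c) (x : M) (a : R) : M := (a : R^c) *: x.

Definition fin_dim (M : lmodType R^c) : Prop :=
  exists (d : nat) (b : 'I_d -> M), forall x : M,
    exists c : 'I_d -> k, x = \sum_(i < d) ract (b i) (eta (c i)).

Record fdmod := FdMod {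
  fdmod_sort :> lmodType R^c;
  fdmodP : fin_dim fdmod_sort
}.

Definition epi (M N : fdmod) (f : {linear M -> N}) : Prop :=
  forall y, exists x, f x = y.

Definition isomorphic (M N : fdmod) : Prop :=
  exists f : {linear M -> N}, bijective f.

Definition short_exact (L M N : fdmod)
    (f : {linear L -> M}) (g : {linear M -> N}) : Prop :=
  [/\ injective f, epi g & forall x, g x = 0 <-> exists y, f y = x].

(* The filtration is built from the bottom: [N] is its top factor. *)
Inductive filt (X : fdmod -> Prop) : fdmod -> Prop :=
| filt_zero (M : fdmod) : (forall x : M, x = 0) -> filt X M
| filt_ext (L M N F : fdmod) (f : {linear L -> M}) (g : {linear M -> N}) :
    short_exact f g -> filt X L -> X F -> isomorphic N F -> filt X M.

Definition projective (P : fdmod) : Prop :=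
  forall (M N : fdmod) (g : {linear M -> N}) (f : {linear P -> N}),
    epi g -> exists h : {linear P -> M}, forall x, g (h x) = f x.

Definition projective_cover (P S : fdmod) : Prop :=
  projective P /\
  exists p : {linear P -> S}, epi p /\
    forall (M : fdmod) (h : {linear M -> P}),
      (forall y, exists x, p (h x) = y) -> epi h.

(* [D] is the largest quotient of [P] satisfying [X]: every other one is a
   quotient of [D], compatibly with the projections from [P]. *)
Definition maximal_quotient (X : fdmod -> Prop) (P D : fdmod) : Prop :=
  X D /\
  exists q : {linear P -> D}, epi q /\
    forall (N : fdmod) (f : {linear P -> N}), X N -> epi f ->
      exists g : {linear D -> N}, forall x, g (q x) = f x.

(* End(M) is isomorphic to [k] as a [k]-algebra: an isomorphism k -> End(M) has
   to be the structure map. *)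
Definition end_is_scalar (M : fdmod) : Prop :=
  forall f : {linear M -> M}, exists! c : k, forall x : M, f x = ract x (eta c).

Definition highest_weight (n : nat) (S : 'I_n -> fdmod) : Prop :=
  exists P Delta : 'I_n -> fdmod,
    [/\ forall i : 'I_n, projective_cover (P i) (S i),
      forall i : 'I_n, maximal_quotient
        (filt (fun M => exists2 j : 'I_n, (j <= i)%N & M = S j)) (P i) (Delta i),
      forall i : 'I_n, end_is_scalar (Delta i) &
      forall i : 'I_n,
        filt (fun M => exists2 j : 'I_n, (i <= j)%N & M = Delta j) (P i)].

End FdModules.

(* [S_i] is [k] with [e_i] acting as the identity, and all other trivial paths
   and all arrows acting as zero. *)
Definition vertex_simple (k : fieldType) (n : nat) (Q : quiver n)
  (I : ideal (path_alg k Q)) (I_adm : admissible I) (i : 'I_n) : Type := k.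

Section VertexSimple.
Variables (k : fieldType) (n : nat) (Q : quiver n).
Variables (I : ideal (path_alg k Q)) (I_adm : admissible I) (i : 'I_n).
Local Notation A := (quot_ring I).
Local Notation S := (vertex_simple I_adm i).

HB.instance Definition _ := GRing.Zmodule.on S.

Definition trivial_coef (a : A) : k := path_coef (ptrivial i) (quot_repr a).

Lemma trivial_coef_pi x : trivial_coef (quot_pi I x) = path_coef (ptrivial i) x.
Proof.
apply/eqP; rewrite -subr_eq0 -mulN1r -path_coefZ -path_coefD scaleN1r.
by rewrite (admissible_trivial0 _ I_adm) ?quot_reprP.
Qed.

Lemma trivial_coefD : {morph trivial_coef : a b / a + b}.
Proof.
move=> a b; rewrite -[a]quot_reprK -[b]quot_reprK -quot_piD.
by rewrite !trivial_coef_pi path_coefD.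
Qed.

Lemma trivial_coefM : {morph trivial_coef : a b / a * b}.
Proof.
move=> a b; rewrite -[a]quot_reprK -[b]quot_reprK -rmorphM.
by rewrite !trivial_coef_pi path_coef_trivialM.
Qed.

Lemma trivial_coef1 : trivial_coef 1 = 1.
Proof. by rewrite -(rmorph1 (quot_pi I)) trivial_coef_pi path_coef_trivial1. Qed.

Definition simple_scale (a : A^c) (x : S) : S := x * trivial_coef a.

Lemma simple_scaleA a b x :
  simple_scale a (simple_scale b x) = simple_scale (a * b) x.
Proof. by rewrite /simple_scale -[a * b]/((b : A) * a) trivial_coefM mulrA. Qed.

Lemma simple_scale1 : left_id 1 simple_scale.
Proof. by move=> x; rewrite /simple_scale trivial_coef1 mulr1. Qed.

Lemma simple_scaleDr : right_distributive simple_scale +%R.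
Proof. by move=> a x y; rewrite /simple_scale mulrDl. Qed.

Lemma simple_scaleDl x : {morph simple_scale^~ x : a b / a + b}.
Proof. by move=> a b; rewrite /simple_scale trivial_coefD mulrDr. Qed.

HB.instance Definition _ := GRing.Zmodule_isLmodule.Build A^c S
  simple_scaleA simple_scale1 simple_scaleDr simple_scaleDl.

Lemma vertex_simple_fin_dim : fin_dim (bound_scalar I) S.
Proof.
exists 1%N, (fun=> 1 : k) => x; exists (fun=> x : k).
rewrite big_ord1 /ract -[RHS]/(1 * trivial_coef (bound_scalar I x)).
rewrite trivial_coef_pi /path_alg_scalar path_coefZ path_coef_trivial1.
by rewrite mul1r mulr1.
Qed.

Definition vertex_simple_mod : fdmod (bound_scalar I) :=
  FdMod vertex_simple_fin_dim.

End VertexSimple.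

(* Main.v *)
Require Import Defs.
From HB Require Import structures.
From mathcomp Require Import all_boot all_order all_algebra.
From mathcomp Require Import finmap boolp classical_sets cardinality.
From mathcomp.multinomials Require Import monalg.

Set Implicit Arguments.
Unset Strict Implicit.
Unset Printing Implicit Defensive.

Import GRing.Theory.

(* Call [gluing] the following property: if [q] ends and [r] starts at a vertex
   that is maximal on both of them, and neither is in [I], then [q r] is not in
   [I].  All three conditions are equivalent to it.

   A minimal path of [I] with a maximal internal vertex is a failure of gluing,
   and conversely the minimal subpath of a failure [q r] contains neither [q] nor
   [r], so that the gluing vertex is internal to it.  Gluing also excludes
   nontrivial cycles at their maximal vertex, since all their powers would avoid
   [I].  Cutting a path at a maximal vertex embeds the paths counted by pi^n_im
   in the pairs counted by the sum over j, and gluing says that this embedding is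
   onto.

   P_i has as a basis the paths from [i] not in [I], and Delta_i those of them
   that stay in the vertices up to [i].  Under gluing, sorting the paths by their
   initial segment up to the maximal vertex filters P_i with layers Delta_j.

   Conversely, let M_{>j} be the submodule of [M] generated by the [M e_l] with
   [l > j].  If 0 -> L -> M -> Delta_l -> 0 is exact then L_{>j} is the
   intersection of [L] with M_{>j}.  By induction along the filtration it follows
   that, for [M] in Filt(Delta), for [x] in [M e_j], and for a path [r] in the
   basis of Delta_j, [x r] is in M_{>j} only if [x] is.  For [M = P_i] and [x] a
   path [q] from [i] to its maximal vertex [j], this shows [q r <> 0] in P_i. *)

(** * Paths *)

Section PathCombinatorics.
Variables (n : nat) (Q : quiver n).
Implicit Types (p q r s g : qpath Q) (u v w : seq (arrow Q)).

Lemma qpath_eq p q : psrc p = psrc q -> parrows p = parrows q -> p = q.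
Proof.
move=> e1 e2; apply: val_inj => /=.
by rewrite [qpath_val p]surjective_pairing [qpath_val q]surjective_pairing; congr pair.
Qed.

Lemma psplit k p : exists q r, [/\ pconcat q r = Some p,
  parrows q = take k (parrows p) & parrows r = drop k (parrows p)].
Proof.
have := qpathP p; rewrite -/(psrc p) -/(parrows p) -{1}(cat_take_drop k (parrows p)).
rewrite composable_cat => /andP[cq cr].
exists (@QPath _ _ (psrc p, take k (parrows p)) cq), (@QPath _ _ (_, drop k (parrows p))
  cr).
by split=> //; apply/pconcat_some; split=> //; rewrite cat_take_drop.
Qed.

(** The sources are compared as well, because trivial paths at different vertices have the same
    empty sequence of arrows. *)
Definition pprefix p r := (psrc p == psrc r) && prefix (parrows p) (parrows r).

Lemma pprefixP p r : reflect (exists q, pconcat p q = Some r) (pprefix p r).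
Proof.
apply: (iffP andP) => [[/eqP e /prefixP[w ew]]|[q /pconcat_some[_ -> ->]]]; last first.
  by rewrite eqxx prefix_prefix.
have [p' [q [e1 e2 e3]]] := psplit (size (parrows p)) r.
exists q; suff -> : p = p' by [].
case/pconcat_some: e1 => _ e1 _; apply: qpath_eq; first by rewrite e.
by rewrite e2 ew take_size_cat.
Qed.

Lemma pprefix_refl p : pprefix p p.
Proof. by rewrite /pprefix eqxx prefix_refl. Qed.

Lemma pprefix_trans q p r : pprefix p q -> pprefix q r -> pprefix p r.
Proof.
case/andP=> /eqP e1 h1 /andP[/eqP e2 h2].
by rewrite /pprefix e1 e2 eqxx (prefix_trans h1 h2).
Qed.

Lemma pprefix_total p q r : pprefix p r -> pprefix q r -> pprefix p q || pprefix q p.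
Proof.
case/andP=> /eqP e1; rewrite prefixE => /eqP h1 /andP[/eqP e2]; rewrite prefixE => /eqP h2.
rewrite /pprefix e1 e2 eqxx /= !prefixE;
  have [le|/ltnW le] := leqP (size (parrows p)) (size (parrows q)).
  by rewrite -{1}h2 take_takel // h1 eqxx.
by rewrite -{3}h1 take_takel // h2 eqxx orbT.
Qed.

Lemma pprefix_anti p q : pprefix p q -> (size (parrows q) <= size (parrows p))%N -> p = q.
Proof.
case/andP=> /eqP e1 /prefixP[u eu] le; apply: qpath_eq => //.
by move: le; rewrite eu size_cat; case: u {eu} => [|a u];
  rewrite ?cats0 //= addnS ltnNge leq_addr.
Qed.

Lemma size_pconcat p q r : pconcat p q = Some r ->
  size (parrows r) = (size (parrows p) + size (parrows q))%N.
Proof. by case/pconcat_some=> _ _ ->; rewrite size_cat. Qed.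

Lemma pvertices_concat p q r : pconcat p q = Some r ->
  pvertices r = pvertices p ++ map tgt (parrows q).
Proof. by case/pconcat_some=> _ e1 e2; rewrite /pvertices e1 e2 map_cat. Qed.

Lemma ptgt_in p : ptgt p \in pvertices p.
Proof. exact: mem_last. Qed.

Lemma psrc_in p : psrc p \in pvertices p.
Proof. exact: mem_head. Qed.

Lemma path_within_concat m p q r : pconcat p q = Some r ->
  path_within m r = path_within m p && path_within m q.
Proof.
move=> e; case/pconcat_some: (e) => e1 _ _.
rewrite /path_within (pvertices_concat e) all_cat.
case hp: (all _ (pvertices p)) => //; rewrite [pvertices q]/pvertices /= -e1.
by rewrite (allP hp _ (ptgt_in p)).
Qed.

Lemma path_within_tgt m p : path_within m p -> (ptgt p < m)%N.
Proof. by move=> /allP; apply; exact: ptgt_in. Qed.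

Lemma path_within_src m p : path_within m p -> (psrc p < m)%N.
Proof. by move=> /allP; apply; exact: psrc_in. Qed.

Lemma path_within_full p : path_within n p.
Proof. by apply/allP => i _; exact: ltn_ord. Qed.

Lemma split_at_vertex (x : 'I_n) p : x \in pvertices p ->
  exists q r, pconcat q r = Some p /\ ptgt q = x.
Proof.
(* The position of [x] among the vertices is the number of arrows before it, as the source has
   position 0. *)
move=> hx; have [q [r [e1 e2 e3]]] := psplit (index x (pvertices p)) p.
exists q, r; split=> //; case/pconcat_some: e1 => _ e1 _.
rewrite /ptgt -e1 e2; move: hx; rewrite /pvertices.
elim: (parrows p) (psrc p) => [|a w IH] i; first by rewrite inE => /eqP ->.
rewrite inE => /orP[/eqP -> /=|h]; first by rewrite eqxx.
by rewrite /=; case: (i =P x) => [//|ne] /=; exact: IH.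
Qed.

(** A cut of [p] at a vertex that is maximal on [p]. It need not be unique, since [p] may pass
    through that vertex several times. *)
Definition maxprefix q p := pprefix q p && path_within (ptgt q).+1 p.

Lemma maxprefix_exists p : exists q, maxprefix q p.
Proof.
pose x := [arg max_(i > psrc p in pvertices p) nat_of_ord i].
have [x_in x_max] : x \in pvertices p /\ forall y, y \in pvertices p -> (y <= x)%N.
  by rewrite /x; case: arg_maxnP; [exact: psrc_in|move=> i hi hm; split].
have [q [r [e1 e2]]] := split_at_vertex x_in; exists q; rewrite /maxprefix.
by apply/andP; split; [apply/pprefixP; exists r|rewrite e2; apply/allP => y /x_max].
Qed.

Lemma pprefix_within m q p : pprefix q p -> path_within m p -> path_within m q.
Proof. by case/pprefixP=> r e; rewrite (path_within_concat m e) => /andP[]. Qed.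

(** Each of the two end vertices lies on [p], hence is bounded by the other. *)
Lemma maxprefix_tgt q q' p : maxprefix q p -> maxprefix q' p -> ptgt q = ptgt q'.
Proof.
case/andP=> pq wq /andP[pq' wq']; apply/val_inj/eqP; rewrite eqn_leq.
have := path_within_tgt (pprefix_within pq wq');
  have := path_within_tgt (pprefix_within pq' wq).
by rewrite !ltnS => -> ->.
Qed.

Lemma pconcat_inj p q q' r : pconcat p q = Some r -> pconcat p q' = Some r -> q = q'.
Proof.
case/pconcat_some=> e1 e2 e3 /pconcat_some[e1' e2' e3'].
apply: qpath_eq; first by rewrite -e1 -e1'.
by move: e3; rewrite e3' => /eqP; rewrite eqseq_cat // eqxx => /eqP.
Qed.

Lemma subpath_trans p q r : subpath p q -> subpath q r -> subpath p r.
Proof.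
case=> u [v [e1 e2]] [u' [v' [e1' e2']]]; exists (u' ++ u), (v ++ v'); split.
  by rewrite e1' e1 !catA.
by rewrite e2 map_cat last_cat -e2'.
Qed.

Lemma subpath_refl p : subpath p p.
Proof. by exists [::], [::]; rewrite cats0. Qed.

Lemma subpathP g p : subpath g p <->
  exists x y : qpath Q, obind (fun z => pconcat z y) (pconcat x g) = Some p.
Proof.
split=> [[u [v [e1 e2]]]|[u [v]]].
  have [a [b [c1 c2 c3]]] := psplit (size u) p.
  have [g' [d [d1 d2 d3]]] := psplit (size (parrows g)) b.
  have eb : parrows b = parrows g ++ v by rewrite c3 e1 drop_size_cat.
  have -> : g = g'.
    apply: qpath_eq; last by rewrite d2 eb take_size_cat.
    case/pconcat_some: d1 => _ <- _; case/pconcat_some: c1 => <- c1 _.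
    by rewrite /ptgt -c1 c2 e1 take_size_cat.
  by exists a, d; rewrite pconcatA d1.
case e: (pconcat u g) => [x|] //= /pconcat_some[e1 e2 e3].
case/pconcat_some: e => f1 f2 f3; exists (parrows u), (parrows v).
by rewrite e3 f3 catA e2 f2 -f1.
Qed.

Lemma subpath_size g p : subpath g p ->
  (size (parrows g) <= size (parrows p) ?= iff (g == p))%N.
Proof.
case=> u [v [e1 e2]]; split; first by rewrite e1 !size_cat addnCA leq_addr.
apply/eqP/eqP => [|-> //]; rewrite e1 !size_cat => e.
have : (size u + size v == 0)%N by rewrite -(eqn_add2l (size (parrows g))) addn0 addnCA -e.
rewrite addn_eq0 !size_eq0 => /andP[/eqP eu /eqP ev].
by move: e1 e2; rewrite eu ev cats0 /= => e1 e2; apply: qpath_eq.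
Qed.

Lemma pconcat_subpath p q r : pconcat p q = Some r -> subpath p r /\ subpath q r.
Proof.
case/pconcat_some=> e1 e2 e3; split; first by exists [::], (parrows q); rewrite e3 e2.
by exists (parrows p), [::]; rewrite cats0 e3 e2 -e1.
Qed.

(** An internal vertex lies on [p] and forces [p] to have an arrow. Every vertex of such a path is
    an end of one of its arrows, so bounding the arrows and bounding the vertices agree. *)
Lemma within_maximal (x : 'I_n) p : x \in internal p ->
  maximal_vertex p x <-> path_within x.+1 p.
Proof.
move=> xi; have wp : parrows p != [::] by move: xi; rewrite /internal; case: (parrows p).
have xp : x \in pvertices p.
  rewrite inE; apply/orP; right; case/mapP: xi => a /mem_take ha ->; exact: map_f.
split=> [[_ h]|/allP h].
  apply/allP => y; rewrite inE => /orP[/eqP ->|/mapP[a /h /andP[_ ha] ->]];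
    last by rewrite ltnS.
  have := qpathP p; rewrite -/(psrc p) -/(parrows p).
  by case: (parrows p) wp h => // a w _ h /= /andP[/eqP <- _];
    have /andP[] := h a (mem_head _ _).
split=> // a ha.
have ht : tgt a \in pvertices p by rewrite inE map_f ?orbT.
have hs : src a \in pvertices p.
  have := qpathP p; rewrite -/(psrc p) -/(parrows p) /pvertices.
  elim: (parrows p) (psrc p) ha => // b w IH i;
    rewrite inE => /orP[/eqP <-|hw] /= /andP[/eqP eb cw].
    by rewrite -eb mem_head.
  by rewrite inE (IH _ hw cw) orbT.
by rewrite -ltnS h //= -ltnS h.
Qed.

End PathCombinatorics.

(** * The path algebra and its monomial ideals *)

Section PathAlgebra.
Variables (k : fieldType) (n : nat) (Q : quiver n).
Local Notation kQ := (path_alg k Q).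
Implicit Types (p q r : qpath Q) (T U : pred (qpath Q)).
Local Open Scope ring_scope.

Lemma path_coefB p (x y : kQ) : path_coef p (x - y) = path_coef p x - path_coef p y.
Proof. by rewrite path_coefD -scaleN1r path_coefZ mulN1r. Qed.

Lemma of_pathM p q : of_path k p * of_path k q = oapp (@of_path k n Q) 0 (pconcat p q).
Proof. exact: alg_mul_path. Qed.

Lemma of_path_concat p q r : pconcat p q = Some r ->
  of_path k p * of_path k q = of_path k r.
Proof. by move=> e; rewrite of_pathM e. Qed.

Lemma path_algME (x y : kQ) : x * y = \sum_(p <- msupp x) \sum_(q <- msupp y)
    (path_coef p x * path_coef q y) *: (of_path k p * of_path k q).
Proof.
rewrite -[LHS]/(alg_mul x y) unlock; apply: eq_bigr => p _; apply: eq_bigr => q _.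
by rewrite of_pathM.
Qed.

Lemma path_algZl c (x y : kQ) : (c *: x) * y = c *: (x * y).
Proof. exact: alg_mulZl. Qed.

Lemma path_algZr c (x y : kQ) : x * (c *: y) = c *: (x * y).
Proof. exact: alg_mulZr. Qed.

Lemma path_coefM_neq0 r (x y : kQ) : path_coef r (x * y) != 0 ->
  exists p q, [/\ pconcat p q = Some r, path_coef p x != 0 & path_coef q y != 0].
Proof.
move=> h; apply: contrapT => H; case/eqP: h.
rewrite path_algME path_coef_sum big1 // => p _; rewrite path_coef_sum big1 // => q _.
rewrite path_coefZ of_pathM; case e: (pconcat p q) => [r'|] /=;
  last by rewrite path_coef0 mulr0.
rewrite path_coefE; case: eqP => [er|]; last by rewrite mulr0.
have [->|px] := eqVneq (path_coef p x) 0; first by rewrite !mul0r.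
have [->|qy] := eqVneq (path_coef q y) 0; first by rewrite mulr0 mul0r.
by case: H; exists p, q; rewrite -er.
Qed.

(** Left cancellation: [q] is the only path whose concatenation with [p] is [r], so no other term of
    [y] contributes. *)
Lemma path_coefM p q r (y : kQ) : pconcat p q = Some r ->
  path_coef r (of_path k p * y) = path_coef q y.
Proof.
move=> e; rewrite {1 2}[y]path_algE mulr_sumr !path_coef_sum; apply: eq_bigr => s _.
rewrite path_algZr !path_coefZ of_pathM path_coefE; congr (_ * _).
case: (s =P q) => [->|ne]; first by rewrite e /= path_coefE eqxx.
case es: (pconcat p s) => [r'|] /=; last by rewrite path_coef0.
by rewrite path_coefE; case: eqP => // er; case: ne; rewrite er in es;
  exact: pconcat_inj es e.
Qed.

Definition span T : {pred kQ} := fun x => `[< forall p, path_coef p x != 0 -> T p >].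

Lemma spanP T (x : kQ) : reflect (forall p, path_coef p x != 0 -> T p) (x \in span T).
Proof. exact: asboolP. Qed.

Lemma span_coef0 T (x : kQ) p : x \in span T -> ~~ T p -> path_coef p x = 0.
Proof. by move/spanP => /(_ p) h nT; apply/eqP; apply: contraNT nT. Qed.

Lemma span_zmod_closed T : zmod_closed (span T).
Proof.
split=> [|x y sx sy]; apply/spanP => p; first by rewrite path_coef0 eqxx.
by apply: contraNT => nT; rewrite path_coefB (span_coef0 sx) // (span_coef0 sy) // subrr.
Qed.

HB.instance Definition _ T := GRing.isZmodClosed.Build kQ (span T) (span_zmod_closed T).

Lemma spanS T U (x : kQ) : subpred T U -> x \in span T -> x \in span U.
Proof. by move=> TU /spanP h; apply/spanP => p /h /TU. Qed.

Lemma of_path_span T p : T p -> of_path k p \in span T.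
Proof. by move=> Tp; apply/spanP => q; rewrite path_coefE; case: (p =P q) => [<- //|_];
  rewrite eqxx. Qed.

Lemma span_mulr T (x y : kQ) : (forall p r, T p -> pprefix p r -> T r) ->
  x \in span T -> x * y \in span T.
Proof.
move=> Tr /spanP sx; apply/spanP => r /path_coefM_neq0[p [q [e /sx px _]]].
by apply: Tr px _; apply/pprefixP; exists q.
Qed.

Lemma span_ind T (V : kQ -> Prop) : V 0 -> (forall x y, V x -> V y -> V (x + y)) ->
  (forall c p, T p -> V (c *: of_path k p)) -> forall x, x \in span T -> V x.
Proof.
move=> V0 VD Vp x /spanP sx; rewrite [x]path_algE.
apply: (big_ind V) => // p _; have [->|/sx] := eqVneq (path_coef p x) 0; last exact: Vp.
by rewrite scale0r.
Qed.

(** The linear projection of [kQ] onto the span of [T] along the span of the remaining paths. *)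
Definition trunc T (x : kQ) : kQ :=
  \sum_(p <- msupp x | T p) path_coef p x *: of_path k p.

Lemma path_coef_trunc T p (x : kQ) :
  path_coef p (trunc T x) = if T p then path_coef p x else 0.
Proof.
rewrite {2}[x]path_algE /trunc !path_coef_sum; case: ifPn => [Tp|nT].
  rewrite [RHS](bigID T) /= [X in _ + X]big1 ?addr0 // => q nT.
  by rewrite path_coefZ path_coefE; case: eqP nT => [->|_ _]; rewrite ?Tp ?mulr0.
rewrite big1 // => q Tq; rewrite path_coefZ path_coefE.
by case: eqP Tq nT => [->->//|_ _ _]; rewrite mulr0.
Qed.

Lemma trunc_span T (x : kQ) : trunc T x \in span T.
Proof. by apply/spanP => p; rewrite path_coef_trunc; case: ifP; rewrite ?eqxx. Qed.

Lemma truncK T (x : kQ) : x \in span T -> trunc T x = x.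
Proof.
move=> sx; apply: path_algP => p; rewrite path_coef_trunc.
by case: ifPn => // nT; rewrite (span_coef0 sx).
Qed.

Lemma truncD T (x y : kQ) : trunc T (x + y) = trunc T x + trunc T y.
Proof.
apply: path_algP => p; rewrite path_coefD !path_coef_trunc path_coefD.
by case: ifP; rewrite ?addr0.
Qed.

Lemma truncB T (x y : kQ) : trunc T (x - y) = trunc T x - trunc T y.
Proof.
apply: path_algP => p; rewrite path_coefB !path_coef_trunc path_coefB.
by case: ifP; rewrite ?subr0.
Qed.

Lemma trunc_eq0 T (x : kQ) : trunc T x = 0 <-> forall p, T p -> path_coef p x = 0.
Proof.
split=> [e p Tp|h].
  by have := path_coef_trunc T p x; rewrite e path_coef0 Tp.
by apply: path_algP => p; rewrite path_coef_trunc path_coef0; case: ifP => // /h.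
Qed.

Definition convex T := forall p q r, T p -> T r -> pprefix p q -> pprefix q r -> T q.

(** The paths discarded by the inner truncation extend a path of [T] without being in [T]; by
    convexity no extension of them returns to [T]. This makes truncated right multiplication an
    action. *)
Lemma truncM T (x y z : kQ) : convex T -> x \in span T ->
  trunc T (trunc T (x * y) * z) = trunc T (x * y * z).
Proof.
move=> cT sx.
pose U : pred (qpath Q) := fun r => `[< exists2 p, T p & pprefix p r >].
have sU : x * y \in span U.
  apply: span_mulr => [p r /asboolP[q Tq qp] pr|]; first by apply/asboolP;
    exists q => //; apply: pprefix_trans pr.
  by apply: spanS sx => p Tp; apply/asboolP; exists p => //; exact: pprefix_refl.
have : (x * y - trunc T (x * y)) * z \in span (fun r => U r && ~~ T r).
  apply: span_mulr => [p r /andP[/asboolP[q Tq qp] nTp] pr|].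
    apply/andP; split; first by apply/asboolP; exists q => //; apply: pprefix_trans pr.
    by apply: contra nTp => Tr; apply: cT qp pr.
  apply/spanP => r; rewrite path_coefB path_coef_trunc.
  case: ifPn => [_|nTr]; first by rewrite subrr eqxx.
  by rewrite subr0 => /(spanP _ _ sU) Ur; rewrite Ur.
move=> s0; apply/eqP; rewrite eq_sym -subr_eq0 -truncB -mulrBl; apply/eqP/trunc_eq0 => r Tr.
by rewrite (span_coef0 s0) ?Tr ?andbF.
Qed.

(** * Monomial ideals and the finitely many paths outside them *)

Section MonomialIdeal.
Variable I : ideal kQ.
Hypotheses (I_adm : admissible I) (I_paths : generated_by_paths I).

Definition good : pred (qpath Q) := fun p => of_path k p \notin I.

Lemma goodN p : ~~ good p = (of_path k p \in I).
Proof. by rewrite /good negbK. Qed.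

Lemma ideal_scale c (x : kQ) : x \in I -> c *: x \in I.
Proof. by move=> xI; rewrite -[x]mulr1 -path_algZr; exact: Defs.idealMr. Qed.

Lemma good_concat p q r : pconcat p q = Some r -> good r -> good p && good q.
Proof.
move=> e; rewrite /good -(of_path_concat e) -negb_or; apply: contra.
by case/orP; [apply: Defs.idealMr|apply: idealMl].
Qed.

Lemma good_subpath g p : subpath g p -> good p -> good g.
Proof.
case/subpathP => u [v]; case e: (pconcat u g) => [x|] //= e'.
by move/(good_concat e') => /andP[/(good_concat e)/andP[]].
Qed.

Lemma good_pprefix p r : pprefix p r -> good r -> good p.
Proof. by case/pprefixP=> q e /(good_concat e) /andP[]. Qed.

(** The combinations of paths in [I] form a two-sided ideal, because factors of a good path are
    good, and this ideal contains the generating paths. Membership in [I] can thus be tested on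
    coefficients. *)
Lemma ideal_span (x : kQ) : (x \in I) = (x \in span (predC good)).
Proof.
apply/idP/idP => [xI|]; last first.
  apply: (@span_ind _ (fun z => z \in I)) => [||c p]; rewrite ?rpred0 //;
    first by move=> y z; exact: rpredD.
  by rewrite /= goodN => /ideal_scale.
have Kl (a y : kQ) : y \in span (predC good) -> a * y \in span (predC good).
  move/spanP => sy; apply/spanP => r /path_coefM_neq0[p [q [e _ /sy]]] /=.
  by apply: contra => /(good_concat e) /andP[].
have Kr (a y : kQ) : y \in span (predC good) -> y * a \in span (predC good).
  apply: span_mulr => p r /= + /good_pprefix h; exact: contra.
case: I_paths => X hX.
have /(_ (Ideal Kl Kr)) := (hX x).1 xI; apply => y [p Xp ->].
apply: of_path_span; rewrite /= goodN; apply/hX => K; apply; by exists p.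
Qed.

Lemma good_trivial i : good (ptrivial i).
Proof.
apply/negP => /(admissible_trivial0 i I_adm) /eqP.
by rewrite path_coefE eqxx oner_eq0.
Qed.

(** A path with at least [N] arrows is a multiple of a product of [N] arrows, which lies in the
    power of the arrow ideal that admissibility places in [I]. *)
Lemma long_path_bad : exists N, forall p, good p -> (size (parrows p) < N)%N.
Proof.
case: I_adm => N [_ hN _]; exists N => p; apply: contraTltn => le.
rewrite goodN.
(* The leading trivial path records the source and makes the formula correct for the empty sequence
   too. *)
have prodE (w : seq (arrow Q)) i (h : composable i w) :
      of_path k (@QPath _ _ (i, w) h) =
        of_path k (ptrivial i) * \prod_(a <- w) of_path k (parrow a).
  elim: w i h => [|a w IH] i h.
    by rewrite big_nil mulr1; congr of_path; apply: val_inj.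
  have /andP[/eqP ea ca] := h; rewrite big_cons mulrA.
  have e : pconcat (ptrivial i) (parrow a) = Some (parrow a).
    by rewrite pconcat1p /psrc /= ea eqxx.
  rewrite (of_path_concat e).
  have -> : of_path k (parrow a) = of_path k (parrow a) * of_path k (ptrivial (tgt a)).
    by apply/esym/of_path_concat; rewrite pconcatp1 /ptgt /= eqxx.
  rewrite -mulrA -(IH _ ca); apply/esym/of_path_concat/pconcat_some.
  by split=> //=; rewrite /psrc /= ea.
case: p le => -[i w] h; rewrite /parrows /= => le.
rewrite (prodE _ _ h) -(cat_take_drop N w) big_cat /=; apply: idealMl; apply: Defs.idealMr.
apply: hN.
have sz : size (map (fun a => of_path k (parrow a)) (take N w)) == N.
  by rewrite size_map size_takel.
exists [:: Tuple sz]; split; last by rewrite big_seq1 big_map.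
move=> t; rewrite inE => /eqP -> y /mapP[a _ ->] K; apply; by exists a.
Qed.

(** Good paths have bounded length and there are finitely many arrows. The list [B] is what later
    counts and inductions run over. *)
Lemma good_finite : exists2 B : seq (qpath Q), uniq B & forall p, (p \in B) = good p.
Proof.
have [N hN] := long_path_bad.
pose W := [seq w | m <- iota 0 N, w <- map val (enum {: m.-tuple (arrow Q)})].
pose C : seq (qpath Q) := pmap insub [seq (i, w) | i <- enum 'I_n, w <- W].
have memC p : (size (parrows p) < N)%N -> p \in C.
  move=> lt; rewrite mem_pmap_sub; apply/allpairsP; exists (psrc p, parrows p).
  split=> //=; [by rewrite mem_enum| |exact: surjective_pairing].
  apply/allpairsPdep; exists (size (parrows p)), (parrows p); split=> //;
    first by rewrite mem_iota.
  by apply/mapP; exists (in_tuple (parrows p)); rewrite ?mem_enum.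
exists (undup (filter good C)); first exact: undup_uniq.
move=> p; rewrite mem_undup mem_filter.
by case: (boolP (good p)) => //= /hN /memC ->.
Qed.

End MonomialIdeal.
End PathAlgebra.

(** * Gluing and counting *)

Section Gluing.
Variables (k : fieldType) (n : nat) (Q : quiver n) (I : ideal (path_alg k Q)).
Hypotheses (I_adm : admissible I) (I_paths : generated_by_paths I).
Implicit Types (p q r s g : qpath Q) (i j : 'I_n).
Local Notation good := (good I).

Definition gluing := forall q r s, pconcat q r = Some s -> good q -> good r ->
  path_within (ptgt q).+1 s -> good s.

Definition acyclic := forall p, good p -> ptgt p = psrc p ->
  path_within (psrc p).+1 p -> parrows p = [::].

Lemma gluing_acyclic : gluing -> acyclic.
Proof.
move=> glue c gc tc wc; apply/eqP/contraT; rewrite -size_eq0 -lt0n => c0.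
(* Powers of the cycle [c]: prepending [c] is a gluing at the maximal vertex, so the powers stay
   good while their lengths are unbounded. *)
have pow m : exists s, [/\ good s, psrc s = psrc c, ptgt s = psrc c,
    path_within (psrc c).+1 s & (m <= size (parrows s))%N].
  elim: m => [|m [s [gs ss ts ws le]]]; first by exists c.
  have [t e] : exists t, pconcat c s = Some t.
    by rewrite /pconcat; case: eqP => [h|[]]; [exists (pcat h)|rewrite tc ss].
  have wt : path_within (psrc c).+1 t by rewrite (path_within_concat _ e) wc.
  exists t; split=> //; first by apply: (glue c s) => //; rewrite tc.
  - by case/pconcat_some: e.
  - by rewrite (ptgt_concat e).
  - by rewrite (size_pconcat e) -add1n leq_add.
have [N hN] := long_path_bad I_adm; have [s [/hN lt _ _ _]] := pow N.
by rewrite leqNgt lt.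
Qed.

(** Both cuts end at the same vertex, so the longer one is the shorter one followed by a good cycle
    at its maximal vertex, and such a cycle is trivial. *)
Lemma acyclic_maxprefix p q q' : acyclic -> good p ->
  maxprefix q p -> maxprefix q' p -> q = q'.
Proof.
move=> acyc gp; wlog qq' : q q' / pprefix q q' => [H mq mq'|mq mq'].
  have /orP[h|h] : pprefix q q' || pprefix q' q; last by apply/esym; exact: H.
    by case/andP: mq => h _; case/andP: mq' => h' _; exact: pprefix_total h h'.
  exact: H.
have tt := maxprefix_tgt mq mq'; case/andP: mq => _ w; case/andP: mq' => pq' _.
have [c e] := pprefixP _ _ qq'; have [e1 e2 e3] := (pconcat_some _ _ _).1 e.
apply: qpath_eq => //; rewrite e3 (acyc c) ?cats0 //.
- by case/andP: (good_concat e (good_pprefix pq' gp)).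
- by rewrite -(ptgt_concat e) -tt.
by rewrite -e1; move: (pprefix_within pq' w); rewrite (path_within_concat _ e) => /andP[].
Qed.

Lemma minimal_subpath p : ~~ good p -> exists2 g, subpath g p & minimal_path I g.
Proof.
elim: {p}_.+1 {-2}p (ltnSn (size (parrows p))) => // m IH p le np.
have [[q [sq [ne nq]]]|min] := pselect (exists q, subpath q p /\ q <> p /\ ~~ good q).
  have [|g sg mg] := IH q _ nq; last by exists g => //; exact: subpath_trans sq.
  rewrite -ltnS; apply: leq_trans le; rewrite ltnS ltn_neqAle !(subpath_size sq) andbT.
  exact/eqP.
exists p; first exact: subpath_refl.
split=> [|q sq ne]; first by rewrite -goodN.
by apply: contrapT => nq; apply: min; exists q; split=> //; split=> //; apply/negP.
Qed.

Definition maximal_external := forall p, minimal_path I p ->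
  forall v, v \in internal p -> ~ maximal_vertex p v.

Lemma internal_split (v : 'I_n) p : v \in internal p -> exists q r,
  [/\ pconcat q r = Some p, ptgt q = v & (0 < size (parrows q) < size (parrows p))%N].
Proof.
case/mapP=> a ha ->; move: ha; set w := parrows p => ha.
have [w1 [w2 ew]] : exists w1 w2, take (size w).-1 w = w1 ++ a :: w2.
  by case/splitPr: ha => w1 w2; exists w1, w2.
have {ew} [et ew] : take (size w).-1 w = rcons w1 a ++ w2 /\ w = rcons w1 a ++ (w2 ++
  drop (size w).-1 w).
  by rewrite catA cat_rcons -ew cat_take_drop.
have lt : (size (rcons w1 a) < size w)%N.
  have : (size (take (size w).-1 w) < size w)%N.
    by rewrite size_takel ?leq_pred // prednK // lt0n size_eq0; case: (w) ha.
  by apply: leq_ltn_trans; rewrite et size_cat leq_addr.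
have [q [r [e eq _]]] := psplit (size (rcons w1 a)) p.
move: eq; rewrite -/w {1}ew take_size_cat // => eq.
exists q, r; split=> //; first by rewrite /ptgt eq map_rcons last_rcons.
by rewrite eq lt andbT size_rcons.
Qed.

(** Cutting a minimal path at an internal vertex gives two proper subpaths, which are good; were the
    vertex maximal, gluing would make the whole path good. *)
Lemma gluing_external : gluing -> maximal_external.
Proof.
move=> glue g [gI ming] v vi /(within_maximal vi) wg.
have [q [r [e tq /andP[q0 lt]]]] := internal_split vi.
have [sq sr] := pconcat_subpath e.
have gq : good q by apply: ming sq _ => eqg; rewrite eqg ltnn in lt.
have gr : good r.
  apply: ming sr _ => eqg; move: (size_pconcat e) q0; rewrite eqg => /eqP.
  by rewrite -{1}[size _]add0n eqn_add2r => /eqP <-.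
by have := glue _ _ _ e gq gr; rewrite tq => /(_ wg); rewrite -[good g]negbK goodN gI.
Qed.

Lemma cat_eq_split (T : Type) (a b x y : seq T) : a ++ b = x ++ y -> (size a <= size x)%N ->
  exists2 z, x = a ++ z & b = z ++ y.
Proof.
elim: a x => [|c a IH] [|d x] //=; first by move=> ->; exists [::].
  by move=> ->; exists (d :: x).
by case=> -> /IH h /h[z -> ->]; exists z.
Qed.

Lemma subpath_within m p q : subpath p q -> path_within m q -> path_within m p.
Proof.
case/subpathP=> x [y]; case e: (pconcat x p) => [z|] //= e'.
by rewrite (path_within_concat m e') (path_within_concat m e) => /andP[/andP[]].
Qed.

Lemma external_gluing : maximal_external -> gluing.
Proof.
move=> ext q r s e gq gr ws; apply/contraT => /minimal_subpath[g sg ming].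
have ng : ~~ good g by rewrite goodN; case: ming.
have [u [v [es eg]]] := sg; have /pconcat_some[e1 e2 e3] := e.
rewrite e3 in es; rewrite e2 in eg.
(* If [g] ends within [q], it is a subpath of the good path [q]. *)
have [le|lt] := leqP (size (u ++ parrows g)) (size (parrows q)).
  case/negP: ng; apply: good_subpath gq.
  by move: es; rewrite catA => /esym /cat_eq_split[] // z ez _; exists u, z;
    rewrite ez catA.
(* If [g] starts after [q], it is a subpath of the good path [r]. *)
have [ge|lt'] := leqP (size (parrows q)) (size u).
  case/negP: ng; apply: good_subpath gr.
  have [z ez er] := cat_eq_split es ge.
  by exists z, v; split=> //; rewrite eg ez map_cat last_cat -e1.
(* Otherwise the end of [q] cuts [g] into two nonempty pieces, [z] at the end of [q] and [z'] at the
   beginning of [r]. *)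
have [z ez ev] := cat_eq_split (esym es) (ltnW lt').
have [|z' ez' er] := cat_eq_split (esym ev).
  by move: lt; rewrite ez !size_cat ltn_add2l => /ltnW.
have qi : ptgt q \in internal g.
  have z0 : (0 < size z)%N by rewrite -(ltn_add2l (size u)) addn0 -size_cat -ez.
  have z'0 : (0 < size z')%N.
    by rewrite -(ltn_add2l (size (u ++ z))) addn0 -size_cat -catA -ez' -ez.
  (* Dropping the last arrow of [g] shortens only [z'], so the last arrow of [z], which ends at
     [ptgt q], survives. *)
  rewrite /internal ez' /ptgt ez map_cat last_cat size_cat -subn1 -addnBA // take_cat
    ltnNge leq_addr /=.
  case/lastP: z z0 {ez ev ez' lt lt' z'0} => // z a _; rewrite map_rcons last_rcons;
    apply: map_f.
  by rewrite mem_cat mem_rcons mem_head.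
by case: (ext g ming _ qi); apply/(within_maximal qi)/(subpath_within sg).
Qed.

End Gluing.

(** * The counting formula as a statement about cutting paths *)

Section Counting.
Variables (k : fieldType) (n : nat) (Q : quiver n) (I : ideal (path_alg k Q)).
Hypotheses (I_adm : admissible I).
Variable B : seq (qpath Q).
Hypotheses (uB : uniq B) (memB : forall p, (p \in B) = good I p).
Implicit Types (p q r s g : qpath Q) (i j m : 'I_n).
Local Notation good := (good I).

(** The cardinality in [num_paths] is that of a classical set, which has to be shown finite; the
    list of good paths replaces it by a computable count. *)
Lemma num_paths_count l i j : num_paths I l i j =
  count (fun p => [&& path_within l p, psrc p == i & ptgt p == j]) B.
Proof.
rewrite /num_paths -size_filter; set S := (X in fset_set X).
have SE p : S p <-> p \in [seq p <- B | [&& path_within l p, psrc p == i & ptgt p == j]].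
  rewrite mem_filter memB /=; split; first by case=> w -> -> gp; rewrite w !eqxx.
  by case/andP=> /and3P[w /eqP sp /eqP tp] gp; split.
have finS : finite_set S.
  by apply/finite_seqP; exists [seq p <- B | [&& path_within l p, psrc p == i & ptgt p ==
    j]];
    apply/funext => p; apply/propext/SE.
apply/perm_size/uniq_perm; rewrite ?fset_uniq ?filter_uniq // => p.
by rewrite in_fset_set //; apply/idP/idP; rewrite inE => /SE.
Qed.

(** The pairs counted by the sum over [j], where [j] is the vertex [ptgt u.1] at which the two paths
    meet. *)
Definition glued_pair i m (u : qpath Q * qpath Q) :=
  [&& psrc u.1 == i, ptgt u.1 == psrc u.2, ptgt u.2 == m,
      path_within (ptgt u.1).+1 u.1 & path_within (ptgt u.1).+1 u.2].

Definition glued_pairs i m := [seq u <- [seq (q, r) | q <- B, r <- B] | glued_pair i m u].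

Lemma glued_pairs_uniq i m : uniq (glued_pairs i m).
Proof. by apply/filter_uniq/allpairs_uniq => // -[a b] [c d] _ _ [-> ->]. Qed.

Lemma mem_glued_pairs i m u :
  (u \in glued_pairs i m) = [&& glued_pair i m u, good u.1 & good u.2].
Proof.
rewrite mem_filter -!memB; congr andb; case: u => q r /=.
by apply/allpairsP/andP => [[[a b] [ha hb [-> ->]]]|[hq hr]] //; exists (q, r).
Qed.

Lemma size_glued_pairs i m :
  \sum_(j < n) num_paths I j.+1 i j * num_paths I j.+1 j m = size (glued_pairs i m).
Proof.
have cE T (P : pred T) (s : seq T) : count P s = \sum_(q <- s) P q.
  by rewrite -sum1_count big_mkcond; apply: eq_bigr => q _; case: (P q).
rewrite size_filter cE big_allpairs.
under [LHS]eq_bigr => j _ do rewrite !num_paths_count !cE big_distrlr.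
rewrite [LHS]exchange_big; apply: eq_bigr => q _ /=; rewrite [LHS]exchange_big;
  apply: eq_bigr => r _ /=.
(* For fixed [q] and [r] only the index [j = ptgt q] can contribute. *)
rewrite (bigD1 (ptgt q)) //= big1 ?addn0 => [|j /negbTE ne]; last first.
  by rewrite [ptgt q == j]eq_sym ne !andbF.
rewrite mulnb eqxx andbT /glued_pair /= [psrc r == _]eq_sym; congr nat_of_bool.
by do ![case: (_ == _)] => //; rewrite ?andbT ?andbF // andbC.
Qed.

Definition count_formula := forall i m,
  num_paths I n i m = (\sum_(j < n) num_paths I j.+1 i j * num_paths I j.+1 j m).

Lemma max_split p : exists u : qpath Q * qpath Q,
  pconcat u.1 u.2 = Some p /\ path_within (ptgt u.1).+1 p.
Proof.
by have [q /andP[/pprefixP[r e] wp]] := maxprefix_exists p; exists (q, r).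
Qed.

Definition all_paths i m := [seq p <- B | (psrc p == i) && (ptgt p == m)].

Lemma size_all_paths i m : num_paths I n i m = size (all_paths i m).
Proof.
rewrite num_paths_count size_filter; apply: eq_count => p.
by rewrite path_within_full.
Qed.

(** Cutting every good path from [i] to [m] at one chosen maximal vertex is an injection into the
    glued pairs. The formula makes both finite sets equally large, so every glued pair is a cut of a
    good path. *)
Lemma count_formula_gluing : count_formula -> gluing I.
Proof.
move=> cf q r s e gq gr ws.
have [sp spE] := choice max_split.
pose i := psrc q; pose m := ptgt r.
have usp : uniq (map sp (all_paths i m)).
  rewrite map_inj_uniq ?filter_uniq // => p p' ep.
  by apply: Some_inj; rewrite -(spE p).1 ep (spE p').1.
have sub : {subset map sp (all_paths i m) <= glued_pairs i m}.
  move=> u /mapP[p + ->]; rewrite mem_filter memB => /andP[/andP[/eqP sp_i /eqP tp_m] gp].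
  have [e' w] := spE p; rewrite mem_glued_pairs (good_concat e' gp) andbT.
  rewrite /glued_pair -(ptgt_concat e') tp_m eqxx -(path_within_concat _ e') w.
  by case/pconcat_some: e' => -> <- _; rewrite sp_i !eqxx.
have [|_ eqi] := uniq_min_size usp sub.
  by rewrite size_map -size_all_paths cf size_glued_pairs.
have : (q, r) \in glued_pairs i m.
  rewrite mem_glued_pairs /= gq gr /glued_pair /= !eqxx -(path_within_concat _ e) ws.
  by case/pconcat_some: e => ->; rewrite eqxx.
rewrite -eqi => /mapP[p]; rewrite mem_filter memB => /andP[_ gp] eqr.
by have := (spE p).1; rewrite -eqr /= e => -[->].
Qed.

(** Concatenation sends glued pairs to good paths by gluing. It is injective because the cut at a
    maximal vertex is unique without cycles there, and onto because every path has such a cut. *)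
Lemma gluing_count_formula : gluing I -> count_formula.
Proof.
move=> glue i m; have acyc := gluing_acyclic I_adm glue.
rewrite size_all_paths size_glued_pairs.
(* The default [u.1] is never taken on glued pairs, which are composable. *)
pose c (u : qpath Q * qpath Q) := odflt u.1 (pconcat u.1 u.2).
have cE u : u \in glued_pairs i m ->
  [/\ pconcat u.1 u.2 = Some (c u), good (c u) & path_within (ptgt u.1).+1 (c u)].
  rewrite mem_glued_pairs => /and3P[/and5P[_ /eqP e _ w1 w2] g1 g2].
  have ec : pconcat u.1 u.2 = Some (c u) by rewrite /c /pconcat; case: eqP.
  have wc : path_within (ptgt u.1).+1 (c u) by rewrite (path_within_concat _ ec) w1.
  by split=> //; apply: glue ec g1 g2 wc.
have uc : uniq (map c (glued_pairs i m)).
  rewrite map_inj_in_uniq ?glued_pairs_uniq // =>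
    -[q r] [q' r'] /cE /= [e g w] /cE /= [e' g' w'] ec.
  rewrite -ec in e' w'.
  have mq : maxprefix q (c (q, r)) by rewrite /maxprefix w andbT; apply/pprefixP; exists r.
  have mq' : maxprefix q' (c (q, r)) by rewrite /maxprefix w' andbT; apply/pprefixP;
    exists r'.
  have eq := acyclic_maxprefix acyc g mq mq'; rewrite -eq in e' *.
  by rewrite (pconcat_inj e e').
rewrite -(size_map c); apply/perm_size/uniq_perm; rewrite ?filter_uniq // => p.
rewrite mem_filter memB; apply/andP/mapP => [[/andP[sp tp] gp]|[u hu ->]].
  have [[q r] /= [e w]] := max_split p; exists (q, r); last by rewrite /c /= e.
  rewrite mem_glued_pairs /= (good_concat e gp) andbT.
  rewrite /glued_pair /= -(ptgt_concat e) tp -(path_within_concat _ e) w.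
  by case/pconcat_some: e => -> <- _; rewrite sp !eqxx.
have [e gc _] := cE _ hu; split=> //.
rewrite (ptgt_concat e); move: hu;
  rewrite mem_glued_pairs => /and3P[/and5P[s1 _ -> _ _] _ _].
by case/pconcat_some: e => _ -> _; rewrite s1.
Qed.

Lemma acyclic_count i : acyclic I -> num_paths I i.+1 i i = 1.
Proof.
move=> acyc; rewrite num_paths_count -size_filter.
rewrite -[RHS]/(size [:: @ptrivial n Q i]); apply/perm_size/uniq_perm;
  rewrite ?filter_uniq // => p.
rewrite mem_filter memB inE; apply/idP/eqP => [/andP[/and3P[w /eqP sp /eqP tp] gp]|->].
  by apply: qpath_eq => //; apply: acyc; rewrite ?sp.
by rewrite /path_within /= ltnSn !eqxx good_trivial.
Qed.

End Counting.

(** * Modules presented by sets of paths *)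

Section Modules.
Variables (k : fieldType) (n : nat) (Q : quiver n).
Local Notation kQ := (path_alg k Q).
Variable I : ideal kQ.
Local Notation A := (quot_ring I).
Local Notation fdm := (fdmod (bound_scalar I)).
Implicit Types (p q r : qpath Q) (T : pred (qpath Q)).
Local Open Scope ring_scope.

(** The action of [kQ] through its quotient by [I], so that computations take place with elements of
    the path algebra. *)
Definition act (M : lmodType A^c) (x : M) (a : kQ) : M := ract x (quot_pi I a).

Section ActTheory.
Variable M : lmodType A^c.
Implicit Types (x y : M) (a b : kQ).

Lemma act1 x : act x 1 = x.
Proof. by rewrite /act rmorph1; exact: scale1r. Qed.

Lemma actM x a b : act x (a * b) = act (act x a) b.
Proof. by rewrite /act rmorphM /ract scalerA. Qed.

Lemma actDr x a b : act x (a + b) = act x a + act x b.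
Proof. by rewrite /act rmorphD /ract scalerDl. Qed.

Lemma actBr x a b : act x (a - b) = act x a - act x b.
Proof. by rewrite /act rmorphB /ract scalerBl. Qed.

Lemma actDl x y a : act (x + y) a = act x a + act y a.
Proof. by rewrite /act /ract scalerDr. Qed.

Lemma actBl x y a : act (x - y) a = act x a - act y a.
Proof. by rewrite /act /ract scalerBr. Qed.

Lemma act0 a : act (0 : M) a = 0.
Proof. exact: scaler0. Qed.

Lemma act_ideal x a : a \in I -> act x a = 0.
Proof.
move=> aI; rewrite /act; have -> : quot_pi I a = 0; last exact: scale0r.
by rewrite -(raddf0 (quot_pi I)); apply/quot_piP; rewrite subr0.
Qed.

Lemma act0r x : act x 0 = 0.
Proof. by rewrite act_ideal ?rpred0. Qed.

End ActTheory.

Lemma linear_act (M N : lmodType A^c) (f : {linear M -> N}) x a : f (act x a) = act (f x) a.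
Proof. exact: linearZ. Qed.

Lemma linear_of_act (M N : lmodType A^c) (f : M -> N) :
  (forall x y, f (x + y) = f x + f y) -> (forall x a, f (act x a) = act (f x) a) ->
  exists F : {linear M -> N}, F =1 f.
Proof.
move=> fD fa; have lf : linear f.
  move=> a x y; rewrite fD; congr (_ + _).
  by have := fa x (quot_repr (a : A)); rewrite /act quot_reprK.
pose F : {linear M -> N} := HB.pack f (GRing.isLinear.Build _ _ _ _ f lf); by exists F.
Qed.

Lemma linear_inverse (M N : lmodType A^c) (f : {linear M -> N}) : bijective f ->
  exists g : {linear N -> M}, cancel f g /\ cancel g f.
Proof.
case=> g fg gf; have [x y|x a|G eG] := @linear_of_act N M g.
- by apply: (can_inj fg); rewrite raddfD /= !gf.
- by apply: (can_inj fg); rewrite gf linear_act gf.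
by exists G; split=> x; rewrite eG.
Qed.

(* [M] is generated by [x], and the paths in [T] form a basis of [kQ] modulo
   the annihilator of [x]. *)
Definition presents (M : lmodType A^c) (x : M) T :=
  (forall y, exists a, y = act x a) /\
  (forall a, act x a = 0 <-> forall p, T p -> path_coef p a = 0).

(** Writing an element of [M] as [x a] and sending it to [y a] does not depend on the choice of [a],
    because everything that annihilates [x] annihilates [y]. *)
Lemma presents_map (M N : lmodType A^c) (x : M) (y : N) T : presents x T ->
  (forall a, (forall p, T p -> path_coef p a = 0) -> act y a = 0) ->
  exists f : {linear M -> N}, f x = y.
Proof.
move=> [/choice[s sE] annx] anny.
have wd a b : act x a = act x b -> act y a = act y b.
  move=> e; apply/eqP; rewrite -subr_eq0 -actBr; apply/eqP/anny/annx.
  by rewrite actBr e subrr.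
have [u v|u a|f fE] := @linear_of_act M N (fun z => act y (s z)).
- by rewrite -actDr; apply: wd; rewrite actDr -!sE.
- by rewrite -actM; apply: wd; rewrite actM -!sE.
by exists f; rewrite fE -[RHS]act1; apply: wd; rewrite -sE act1.
Qed.

Lemma presents_ext (M N : lmodType A^c) (x : M) T (f g : {linear M -> N}) :
  presents x T -> f x = g x -> f =1 g.
Proof. by move=> [gx _] e z; have [a ->] := gx z; rewrite !linear_act e. Qed.

Lemma presents_linear_bij (M N : lmodType A^c) (x : M) (y : N) T (f : {linear M -> N}) :
  presents x T -> presents y T -> f x = y -> bijective f.
Proof.
move=> px py e.
have [g ge] : exists g : {linear N -> M}, g y = x.
  by apply: (presents_map py) => a /(px.2 a).2.
by exists g => z; [have [a ->] := px.1 z|have [a ->] := py.1 z];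
  rewrite !linear_act ?e ?ge ?e.
Qed.

Lemma presents_isomorphic (M N : fdm) (x : M) (y : N) T :
  presents x T -> presents y T -> isomorphic M N.
Proof.
move=> px py.
have [f fe] : exists f : {linear M -> N}, f x = y.
  by apply: (presents_map px) => a /(py.2 a).2.
by exists f; exact: presents_linear_bij px py fe.
Qed.

Lemma isomorphic_presents (M N : fdm) (y : N) T :
  isomorphic M N -> presents y T -> exists x : M, presents x T.
Proof.
case=> f /linear_inverse[g [fg gf]] [gy ann]; exists (g y); split.
  by move=> z; have [a e] := gy (f z); exists a; rewrite -linear_act -e fg.
move=> a; rewrite -ann -linear_act; split=> [e|->]; last exact: raddf0.
by rewrite -[act y a]gf e raddf0.
Qed.

End Modules.

(* A convex set of paths not in [I] is a basis of a subquotient of [kQ/I]: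
   the paths with an initial segment in it, modulo those that are not in it.
   For an ideal generated by paths, [pathset_ideal] says that no path of the
   set is in [I]. *)
Record pathset (k : fieldType) (n : nat) (Q : quiver n) (I : ideal (path_alg k Q)) :=
  PathSet {
    pathset_pred :> pred (qpath Q);
    pathset_convex : convex pathset_pred;
    pathset_ideal : forall x, x \in I -> x \in span (predC pathset_pred)
  }.

Record pathmod (k : fieldType) (n : nat) (Q : quiver n) (I : ideal (path_alg k Q))
    (T : pathset I) := PathMod {
  pathmod_val : path_alg k Q;
  pathmodP : pathmod_val \in span T
}.

Section PathModules.
Local Open Scope ring_scope.
Variables (k : fieldType) (n : nat) (Q : quiver n) (I : ideal (path_alg k Q)).
Local Notation kQ := (path_alg k Q).
Local Notation A := (quot_ring I).
Local Notation fdm := (fdmod (bound_scalar I)).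
Implicit Types (p q r : qpath Q) (T : pathset I) (x y : kQ).

HB.instance Definition _ T := [isSub for @pathmod_val k n Q I T].
HB.instance Definition _ T := [Choice of pathmod T by <:].
HB.instance Definition _ T := [SubChoice_isSubZmodule of pathmod T by <:].

Definition pathelt T x : pathmod T := PathMod (trunc_span T x).

Lemma pathmod_valD T : {morph @pathmod_val k n Q I T : u v / u + v}.
Proof. by []. Qed.

Lemma patheltD T x y : pathelt T (x + y) = pathelt T x + pathelt T y.
Proof. by apply: val_inj; exact: truncD. Qed.

Lemma patheltK T (u : pathmod T) : pathelt T (pathmod_val u) = u.
Proof. by apply: val_inj; apply: truncK; exact: pathmodP. Qed.

Lemma pathelt_eq T x y : pathelt T x = pathelt T y <-> x - y \in span (predC T).
Proof.
split=> [e|s].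
  apply/spanP => p /=; apply: contraNN => Tp.
  have : path_coef p (trunc T x) = path_coef p (trunc T y) by case: e => ->.
  by rewrite !path_coef_trunc Tp path_coefB => ->; rewrite subrr.
apply: val_inj => /=; apply/eqP; rewrite -subr_eq0 -truncB; apply/eqP/trunc_eq0 => p Tp.
by rewrite (span_coef0 s) //= Tp.
Qed.

Definition pathmod_scale T (a : A^c) (u : pathmod T) : pathmod T :=
  pathelt T (pathmod_val u * quot_repr a).

Lemma pathelt_mulI T x a : a \in I -> pathelt T (x * a) = 0.
Proof.
move=> aI; rewrite -[RHS](patheltK 0) /=; apply/pathelt_eq; rewrite subr0.
by apply: pathset_ideal; exact: idealMl.
Qed.

Lemma pathmod_scale_pi T (u : pathmod T) a :
  pathmod_scale (quot_pi I a) u = pathelt T (pathmod_val u * a).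
Proof.
apply/eqP; rewrite -subr_eq0; apply/eqP; have := quot_reprP I a.
set b := quot_repr _ => /(pathelt_mulI T (pathmod_val u)).
rewrite mulrBr; move=> e; rewrite -e.
by apply: val_inj; rewrite /= truncB.
Qed.

Lemma pathmod_scaleA T (a b : A^c) (u : pathmod T) :
  pathmod_scale a (pathmod_scale b u) = pathmod_scale (a * b) u.
Proof.
rewrite -[a * b]/((b : A) * (a : A)) -[a](quot_reprK (I := I)) -[b](quot_reprK (I := I)).
rewrite -rmorphM !pathmod_scale_pi.
apply: val_inj => /=; rewrite truncM ?mulrA //; first exact: pathset_convex.
exact: pathmodP.
Qed.

Lemma pathmod_scale1 T : left_id 1 (@pathmod_scale T).
Proof.
move=> u; rewrite -[1](rmorph1 (quot_pi I)) pathmod_scale_pi mulr1; exact: patheltK.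
Qed.

Lemma pathmod_scaleDr T : right_distributive (@pathmod_scale T) +%R.
Proof. by move=> a u v; rewrite /pathmod_scale mulrDl patheltD. Qed.

Lemma pathmod_scaleDl T u : {morph (@pathmod_scale T)^~ u : a b / a + b}.
Proof.
move=> a b; rewrite -[a](quot_reprK (I := I)) -[b](quot_reprK (I := I)).
by rewrite -[quot_pi I _ + _](rmorphD (quot_pi I)) !pathmod_scale_pi mulrDr patheltD.
Qed.

HB.instance Definition _ T := GRing.Zmodule_isLmodule.Build A^c (pathmod T)
  (@pathmod_scaleA T) (@pathmod_scale1 T) (@pathmod_scaleDr T) (@pathmod_scaleDl T).

Lemma pathmod_act T (u : pathmod T) a : act u a = pathelt T (pathmod_val u * a).
Proof. exact: pathmod_scale_pi. Qed.

Lemma pathelt_act T x a : x \in span T -> act (pathelt T x) a = pathelt T (x * a).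
Proof. by move=> sx; rewrite pathmod_act /= truncK. Qed.

Hypotheses (I_adm : admissible I) (I_paths : generated_by_paths I).

Lemma pathset_subgood T : subpred T (good I).
Proof.
move=> p Tp; apply/negP => /(pathset_ideal T) /spanP /(_ p).
by rewrite path_coefE eqxx oner_eq0 /= Tp => /(_ isT).
Qed.

Lemma pathmod_fin_dim T : fin_dim (bound_scalar I) (pathmod T).
Proof.
have [B uB memB] := good_finite I_adm.
exists (size B), (fun i => pathelt T (of_path k (tnth (in_tuple B) i))) => u.
exists (fun i => path_coef (tnth (in_tuple B) i) (pathmod_val u)).
apply: val_inj; apply: path_algP => p /=;
  rewrite (big_morph _ (@pathmod_valD T) (erefl _)) path_coef_sum.
under eq_bigr => i _.
  rewrite -[ract _ _]/(act _ (path_alg_scalar _ _)) pathmod_act /= path_algZr mulr1.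
  rewrite path_coef_trunc path_coefZ path_coef_trunc path_coefE.
  over.
case: (boolP (T p)) => [Tp|nT]; last by rewrite big1 // (span_coef0 (pathmodP u)).
rewrite -(big_tuple _ _ (in_tuple B) xpredT
  (fun q => path_coef q (pathmod_val u) * (q == p)%:R)) /=.
rewrite (bigD1_seq p) ?memB ?(pathset_subgood Tp) //= eqxx mulr1 big1 ?addr0 // => q ne.
by rewrite (negbTE ne) mulr0.
Qed.

Definition pathfdm T : fdm := FdMod (pathmod_fin_dim T).

(** If all paths of [T] start with [q], then [q] generates, and the basis consists of the remainders
    [r] with [q r] in [T]; an [r] that cannot follow [q] is excluded by the value [false]. *)
Lemma pathmod_presents T q : T q -> (forall p, T p -> pprefix q p) ->
  presents (pathelt T (of_path k q) : pathmod T) (fun r => oapp T false (pconcat q r)).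
Proof.
move=> Tq Tpre; have sq : of_path k q \in span T by exact: of_path_span.
split=> [u|a].
  have: exists a, pathmod_val u = of_path k q * a.
    move: (pathmod_val u) (pathmodP u); apply: span_ind => [|_ _ [a ->] [b ->]|c p Tp].
    - by exists 0; rewrite mulr0.
    - by exists (a + b); rewrite mulrDr.
    have /pprefixP[r /(of_path_concat k) <-] := Tpre _ Tp.
    by exists (c *: of_path k r); rewrite path_algZr.
  by case=> a e; exists a; rewrite pathelt_act // -e patheltK.
rewrite pathelt_act //; split=> [e r|h].
  case er: (pconcat q r) => [s|] //= Ts; rewrite -(path_coefM a er).
  have := path_coef_trunc T s (of_path k q * a); rewrite Ts => <-.
  by case: e => ->; rewrite path_coef0.
apply: val_inj; apply/trunc_eq0 => p Tp; have /pprefixP[r er] := Tpre _ Tp.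
by rewrite (path_coefM a er); apply: h; rewrite er.
Qed.

(** As [T1] is closed under extension inside [T], it spans a submodule, and its complement [T2] is a
    basis of the quotient. Both maps are truncations. *)
Lemma path_ses (T T1 T2 : pathset I) :
  (forall p, T p = T1 p || T2 p) -> (forall p, ~~ (T1 p && T2 p)) ->
  (forall p r, T1 p -> T r -> pprefix p r -> T1 r) ->
  exists (f : {linear pathfdm T1 -> pathfdm T}) (g : {linear pathfdm T -> pathfdm T2}),
    short_exact f g.
Proof.
move=> TU TI T1r.
have T1T p : T1 p -> T p by rewrite TU => ->.
have T2T p : T2 p -> T p by rewrite TU => ->; rewrite orbT.
have coef1 x a r : x \in span T1 -> T r -> ~~ T1 r -> path_coef r (x * a) = 0.
  move=> /spanP s1 Tr nT1; apply/eqP;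
    apply: contraNT nT1 => /path_coefM_neq0[p [q [e /s1 T1p _]]].
  by apply: T1r T1p Tr _; apply/pprefixP; exists q.
have [u v|u a|f fE] := @linear_of_act _ _ _ _ (pathmod T1) (pathmod T) (fun u =>
  pathelt T (pathmod_val u)).
- by rewrite pathmod_valD patheltD.
- rewrite pathelt_act; last exact: spanS T1T (pathmodP u).
  rewrite pathmod_act; apply/pathelt_eq/spanP => p /=; apply: contraNN => Tp.
  rewrite path_coefB path_coef_trunc; case: ifPn => [|nT1]; first by rewrite subrr.
  by rewrite (coef1 _ _ _ (pathmodP u)) ?subrr.
have [u v|u a|g gE] := @linear_of_act _ _ _ _ (pathmod T) (pathmod T2) (fun u =>
  pathelt T2 (pathmod_val u)).
- by rewrite pathmod_valD patheltD.
- rewrite !pathmod_act; apply/pathelt_eq/spanP => p /=; apply: contraNN => T2p.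
  rewrite path_coefB path_coef_trunc (T2T _ T2p) -path_coefB -mulrBl; apply/eqP/coef1.
  + apply/spanP => q; rewrite path_coefB path_coef_trunc; apply: contraNT => nT1.
    case: ifPn => [|nT2]; first by rewrite subrr.
    by rewrite subr0 (span_coef0 (pathmodP u)) // TU negb_or nT1.
  + exact: T2T.
  + by apply: contraNN (TI p) => ->.
exists f, g; split.
- move=> u v; rewrite !fE => /pathelt_eq /spanP e; apply: val_inj; apply: path_algP => p.
  have [T1p|nT1] := boolP (T1 p); last by rewrite !(span_coef0 (pathmodP _) nT1).
  by apply/eqP; rewrite -subr_eq0 -path_coefB; apply: contraTT (T1T _ T1p) => /e.
- move=> v; exists (pathelt T (pathmod_val v)); rewrite gE /= truncK ?patheltK //.
  exact: spanS T2T (pathmodP v).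
move=> u; rewrite gE; split=> [e|[v <-]].
  exists (pathelt T1 (pathmod_val u)); rewrite fE /= -[RHS]patheltK; apply/pathelt_eq.
  apply/spanP => p /=; apply: contraNN => Tp; rewrite path_coefB path_coef_trunc.
  case: ifPn => [|nT1]; first by rewrite subrr.
  move: Tp; rewrite TU (negbTE nT1) /= => T2p; rewrite sub0r oppr_eq0.
  have := path_coef_trunc T2 p (pathmod_val u); rewrite T2p => <-.
  by case: e => ->; rewrite path_coef0.
rewrite fE; apply: val_inj => /=; apply/trunc_eq0 => p T2p;
  rewrite path_coef_trunc (T2T _ T2p).
by rewrite (span_coef0 (pathmodP v)) //; apply: contraNN (TI p) => ->.
Qed.

End PathModules.

(** * Projective and standard modules *)

Section StandardModules.
Variables (k : fieldType) (n : nat) (Q : quiver n) (I : ideal (path_alg k Q)).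
Hypotheses (I_adm : admissible I) (I_paths : generated_by_paths I).
Local Notation kQ := (path_alg k Q).
Local Notation A := (quot_ring I).
Local Notation fdm := (fdmod (bound_scalar I)).
Local Notation simple := (vertex_simple_mod I_adm).
Local Notation e_ i := (of_path k (@ptrivial n Q i)).
Local Notation good := (good I).
Local Notation simples_le i := (fun M : fdm => exists2 j : 'I_n, (j <= i)%N & M = simple j).
Implicit Types (p q r : qpath Q) (T : pred (qpath Q)) (a b : kQ) (i j l : 'I_n).
Local Open Scope ring_scope.

Lemma trivialM i j : e_ i * e_ j = if i == j then e_ i else 0.
Proof. by rewrite of_pathM pconcat1p; case: (i =P j) => [<-|] /=; rewrite ?eqxx //;
  case: eqP. Qed.

Lemma trivialMr p : of_path k p * e_ (ptgt p) = of_path k p.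
Proof. by apply: of_path_concat; rewrite pconcatp1 eqxx. Qed.

Lemma path_coef_trivialMl p a : path_coef p (e_ (psrc p) * a) = path_coef p a.
Proof. by apply: path_coefM; rewrite pconcat1p eqxx. Qed.

Lemma path_coef1 p : path_coef p (1 : kQ) = (parrows p == [::])%:R.
Proof.
rewrite -path_coef_trivialMl mulr1 path_coefE; congr (nat_of_bool _)%:R.
by apply/eqP/eqP => [<- //|e]; apply: qpath_eq.
Qed.

Lemma trivial_mul_span i a : e_ i * a \in span (fun p =>
  (psrc p == i) && (path_coef p a != 0)).
Proof.
apply/spanP => p /path_coefM_neq0[q [r [e]]]; rewrite path_coefE.
case: (_ =P q) e => [<-|_]; last by rewrite eqxx.
by rewrite pconcat1p; case: eqP => // -> [<-] _ ->; rewrite eqxx.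
Qed.

(** Modulo [I] an element without trivial paths is nilpotent, so [1 + r] is inverted by the finite
    geometric series in [- r]. *)
Lemma one_add_unit (r : kQ) : r \in span (fun p => parrows p != [::]) ->
  exists v, (1 + r) * v - 1 \in I /\ v * (1 + r) - 1 \in I.
Proof.
move=> sr; have [N hN] := long_path_bad I_adm.
have pow m : r ^+ m \in span (fun p => m <= size (parrows p))%N.
  elim: m => [|m IH]; first by apply/spanP.
  apply/spanP => p; rewrite exprS =>
    /path_coefM_neq0[s [t [/size_pconcat -> /(spanP _ _ sr) hs]]].
  move=> /(spanP _ _ IH) ht; rewrite -add1n leq_add //.
  by case: (parrows s) hs.
have rI : (- r) ^+ N \in I.
  rewrite exprNn; apply: Defs.idealMl; rewrite (ideal_span I_paths).
  by apply: spanS (pow N) => p le; apply: contraL le => /hN; rewrite -ltnNge.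
have e : (1 + r) * (\sum_(i < N) (- r) ^+ i) = 1 - (- r) ^+ N.
  by apply: oppr_inj; rewrite opprB subrX1 -mulNr opprD addrC.
have c : (\sum_(i < N) (- r) ^+ i) * (1 + r) = (1 + r) * (\sum_(i < N) (- r) ^+ i).
  rewrite mulr_suml mulr_sumr; apply: eq_bigr => i _; rewrite mulrDr mulrDl mulr1 mul1r.
  by congr (_ + _); apply/esym/commrX/commrN/commr_refl.
by exists (\sum_(i < N) (- r) ^+ i); rewrite c e addrC addKr rpredN.
Qed.

(** The corner ring at [i] is local: on it [u] agrees with [1 + r] for [r = u - e_i], which involves
    only nontrivial paths. *)
Lemma corner_unit i b : path_coef (ptrivial i) b = 1 ->
  let u := e_ i * b * e_ i in exists v, u * v - e_ i \in I /\ v * u - e_ i \in I.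
Proof.
move=> b1 u; pose r := u - e_ i.
have eu : e_ i * u = u by rewrite /u !mulrA trivialM eqxx.
have ue : u * e_ i = u by rewrite /u -!mulrA trivialM eqxx.
have er : e_ i * (1 + r) = u by rewrite mulrDr mulr1 mulrBr eu trivialM eqxx addrC subrK.
have re : (1 + r) * e_ i = u by rewrite mulrDl mul1r mulrBl ue trivialM eqxx addrC subrK.
have sr : r \in span (fun p => parrows p != [::]).
  apply/spanP => p; apply: contraNN => /eqP ep.
  have {ep} -> : p = ptrivial (psrc p) by apply: qpath_eq.
  move: (psrc p) => j; rewrite path_coefB /u !path_coef_trivialM path_coefE.
  case: (ptrivial i =P ptrivial j) => [<-|_]; last by rewrite !mul0r subrr.
  by rewrite b1 !mulr1 subrr.
have [v [h1 h2]] := one_add_unit sr.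
exists v; split.
  by have := Defs.idealMl (e_ i) h1; rewrite mulrBr mulr1 mulrA er.
by have := Defs.idealMr (e_ i) h2; rewrite mulrBl mul1r -mulrA re.
Qed.

Lemma simple_act i (s : simple i) a : act s a = (s : k) * path_coef (ptrivial i) a.
Proof. by rewrite -(trivial_coef_pi I_adm). Qed.

Lemma simple_presents i : presents ((1 : k) : simple i) (pred1 (ptrivial i)).
Proof.
split=> [s|a]; first exists (path_alg_scalar Q s).
  by rewrite simple_act path_coefZ path_coef_trivial1 mulr1 mul1r.
rewrite simple_act mul1r; split=> [e p /eqP -> //|]; by apply; rewrite /= eqxx.
Qed.

(** Kept transparent, since later proofs compute its underlying predicate. *)
Definition goodset T (cT : convex T) (gT : subpred T good) : pathset I.
Proof.
exists T => // x; rewrite (ideal_span I_paths); apply: spanS => p /=.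
by apply: contraNN; exact: gT.
Defined.

Lemma presents_eq (M : lmodType A^c) (x : M) T T' : T =1 T' -> presents x T ->
  presents x T'.
Proof.
move=> e [gx ann]; split=> // a; rewrite ann.
by split=> h p; [rewrite -e|rewrite e]; exact: h.
Qed.

Lemma presents_act_src (M : lmodType A^c) (x : M) T i a : presents x T ->
  (forall p, T p -> psrc p = i) -> act x (e_ i * a) = act x a.
Proof.
move=> [_ ann] sT; apply/eqP; rewrite -subr_eq0 -actBr; apply/eqP/ann => p /sT <-.
by rewrite path_coefB path_coef_trivialMl subrr.
Qed.

Lemma presents_act_trivial (M : lmodType A^c) (x : M) T i : presents x T ->
  (forall p, T p -> psrc p = i) -> act x (e_ i) = x.
Proof. by move=> px sT; rewrite -[e_ i]mulr1 (presents_act_src 1 px sT) act1. Qed.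

(** * Path bases of the projective and the standard modules *)

Definition proj_basis i : pred (qpath Q) := fun p => (psrc p == i) && good p.

Definition std_basis i : pred (qpath Q) :=
  fun p => [&& psrc p == i, path_within i.+1 p & good p].

Lemma proj_basis_src i p : proj_basis i p -> psrc p = i.
Proof. by case/andP=> /eqP. Qed.

Lemma std_basis_src i p : std_basis i p -> psrc p = i.
Proof. by case/andP=> /eqP. Qed.

Lemma proj_basis_trivial i : proj_basis i (ptrivial i).
Proof. by rewrite /proj_basis eqxx good_trivial. Qed.

Lemma std_basis_trivial i : std_basis i (ptrivial i).
Proof. by rewrite /std_basis eqxx good_trivial // /path_within /= ltnSn. Qed.

Lemma std_basis_proj i : subpred (std_basis i) (proj_basis i).
Proof. by move=> p /and3P[h1 _ h2]; rewrite /proj_basis h1. Qed.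

Lemma proj_convex i : convex (proj_basis i).
Proof.
move=> p q r /andP[/eqP <- _] /andP[_ gr] /andP[/eqP e _] qr.
by rewrite /proj_basis e eqxx (good_pprefix qr).
Qed.

Lemma std_convex i : convex (std_basis i).
Proof.
move=> p q r /and3P[/eqP <- _ _] /and3P[_ wr gr] /andP[/eqP e _] qr.
by rewrite /std_basis e eqxx (good_pprefix qr) // andbT -e (pprefix_within qr).
Qed.

Definition projmod i : fdm :=
  pathfdm I_adm (goodset (@proj_convex i) (fun p h => proj2 (andP h))).

Definition stdmod i : fdm :=
  pathfdm I_adm (goodset (@std_convex i) (fun p h => proj2 (andP (std_basis_proj h)))).

Lemma trivial_presents T (S : pathset I) i : T =1 S -> T (ptrivial i) ->
  (forall p, T p -> psrc p = i) -> exists x : pathfdm I_adm S, presents x T.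
Proof.
move=> eT T1 sT; have [|p|] := @pathmod_presents _ _ _ _ S (ptrivial i).
- by rewrite -eT.
- by rewrite -eT => /sT <-; rewrite /pprefix eqxx prefix0s.
move=> h1 h2; exists (pathelt S (e_ i)).
apply: (presents_eq (M := pathmod S) _ (conj h1 h2)) => p.
rewrite pconcat1p eq_sym; case: eqP => [_|ne] /=; first by rewrite eT.
by apply/esym; apply: contraPF (ne) => /sT.
Qed.

Lemma projmod_presents i : exists x : projmod i, presents x (proj_basis i).
Proof. by apply: trivial_presents; [|exact: proj_basis_trivial|exact: proj_basis_src]. Qed.

Lemma stdmod_presents i : exists x : stdmod i, presents x (std_basis i).
Proof. by apply: trivial_presents; [|exact: std_basis_trivial|exact: std_basis_src]. Qed.

(** This is behind Hom(P_i, M) = M e_i: modulo [I], the element [e_i a] involves only good paths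
    from [i]. *)
Lemma proj_ann (M : lmodType A^c) (z : M) i a : act z (e_ i) = z ->
  (forall p, proj_basis i p -> path_coef p a = 0) -> act z a = 0.
Proof.
move=> <- h; rewrite -actM; apply: act_ideal; rewrite (ideal_span I_paths).
apply: spanS (trivial_mul_span i a) => p /andP[sp]; apply: contraNN => gp.
by rewrite h // /proj_basis sp.
Qed.

Lemma act_trivialK (M : lmodType A^c) (z : M) i : act (act z (e_ i)) (e_ i) = act z (e_ i).
Proof. by rewrite -actM trivialM eqxx. Qed.

Lemma presents_projective_cover (P : fdm) (x : P) i :
  presents x (proj_basis i) -> projective_cover P (simple i).
Proof.
move=> px; have xe := presents_act_trivial px (@proj_basis_src i).
split=> [M N g f epi_g|].
  have [m gm] := epi_g (f x).
  have [h hx] : exists h : {linear P -> M}, h x = act m (e_ i).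
    by apply: (presents_map px) => a; apply: proj_ann; exact: act_trivialK.
  exists h; apply: (presents_ext (f := g \o h) px).
  by rewrite /= hx linear_act gm -linear_act xe.
have [f fx] : exists f : {linear P -> simple i}, f x = (1 : k).
  apply: (presents_map px) => a h.
  by rewrite simple_act h ?mulr0 //; exact: proj_basis_trivial.
exists f; split=> [y|M h surj].
  exists (act x (path_alg_scalar Q y)); rewrite linear_act fx simple_act mul1r.
  by rewrite path_coefZ path_coef_trivial1 mulr1.
(* A submodule mapping onto the simple module contains some [x b] with [b] of coefficient one at the
   trivial path; [b] is then a unit in the corner, so the submodule contains [x]. *)
have [m fm] := surj (1 : k).
have [b eb] := px.1 (h m).
have b1 : path_coef (ptrivial i) b = 1.
  by move: fm; rewrite eb linear_act fx simple_act mul1r.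
have [v [uv _]] := corner_unit b1.
move=> y; have [a ->] := px.1 y.
exists (act (act m (e_ i)) (v * a)).
have -> : act x a = act x (e_ i * b * e_ i * v * a).
  apply/esym/eqP; rewrite -subr_eq0 -(presents_act_src a px (@proj_basis_src i)).
  by rewrite -actBr -mulrBl act_ideal //; exact: Defs.idealMr.
by rewrite -actM linear_act eb -actM -!mulrA (presents_act_src _ px (@proj_basis_src i)).
Qed.

(* [P] is a summand of the concrete projective module; the splitting maps the
   generator to a unit of the corner ring at [i]. *)
Lemma projective_cover_presents (P : fdm) i :
  projective_cover P (simple i) -> exists x : P, presents x (proj_basis i).
Proof.
case=> projP [p [epi_p cover_p]].
have [x0 px0] := projmod_presents i; set P0 := projmod i in x0 px0.
have [x' px'] := epi_p (1 : k); pose x := act x' (e_ i).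
have xe : act x (e_ i) = x by exact: act_trivialK.
have px : p x = (1 : k).
  by rewrite linear_act px' simple_act path_coefE eqxx mulr1.
have [f fx] : exists f : {linear P0 -> P}, f x0 = x.
  by apply: (presents_map px0) => a; exact: proj_ann.
have epi_f : epi f.
  apply: cover_p => y; exists (act x0 (path_alg_scalar Q y)).
  rewrite !linear_act fx px simple_act mul1r.
  by rewrite path_coefZ path_coef_trivial1 mulr1.
have [s fs] := projP P0 P f idfun epi_f.
have [b eb] := px0.1 (s x).
have sx : s x = act x0 (e_ i * b * e_ i).
  by rewrite -mulrA (presents_act_src _ px0 (@proj_basis_src i)) actM -eb -linear_act xe.
have b1 : path_coef (ptrivial i) b = 1.
  have := fs x => /= /(congr1 p); rewrite px sx !linear_act fx px simple_act mul1r.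
  by rewrite !path_coef_trivialM path_coefE eqxx mul1r mulr1.
have [v [_ vu]] := corner_unit b1; set u := e_ i * b * e_ i in sx vu.
exists x; split=> [y|a].
  by have [z <-] := epi_f y; have [a ->] := px0.1 z; exists a; rewrite linear_act fx.
split=> [xa|]; last exact: proj_ann.
(* From [x a = 0] it follows that [u a] is in [I], and multiplying by the inverse [v] that [e_i a]
   is in [I]. *)
have uaI : u * a \in I.
  have : act x0 (u * a) = 0 by rewrite actM -sx -linear_act xa raddf0.
  move/(px0.2 _) => h; rewrite (ideal_span I_paths).
  rewrite /u -!mulrA; apply: spanS (trivial_mul_span i _) => q /andP[sq].
  apply: contraNN => gq; rewrite -(eqP sq) -path_coef_trivialMl (eqP sq) !mulrA h //.
  by rewrite /proj_basis sq.
have eaI : e_ i * a \in I.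
  have := rpredB (Defs.idealMl v uaI) (Defs.idealMr a vu).
  by rewrite mulrBl mulrA opprB addrC subrK.
move=> q /andP[/eqP sq gq]; apply/eqP.
rewrite -path_coef_trivialMl sq; move: eaI;
  rewrite (ideal_span I_paths) => /spanP /(_ q) /=.
by rewrite gq; case: eqP => // _ /(_ isT).
Qed.

(** * Filtrations by simple modules and maximal quotients *)

Lemma simples_act0 i j (M : fdm) : (i < j)%N -> filt (simples_le i) M ->
  forall x : M, act x (e_ j) = 0.
Proof.
move=> ij; elim=> [M0 M0_0|L M1 N F f g [inj_f _ ker] _ IH [l li ->] [h bij_h]] x.
  exact: M0_0.
(* The idempotent [e_j] kills the top factor, so [x e_j] comes from [L], where a second application
   of [e_j] gives zero. *)
have [y xy] : exists y, f y = act x (e_ j).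
  apply/ker/(bij_inj bij_h); rewrite !linear_act raddf0 simple_act path_coefE.
  case: (ptrivial j =P ptrivial l) => [[e]|_]; last by rewrite mulr0.
  by move: ij; rewrite ltnNge e li.
by rewrite -act_trivialK -xy -linear_act IH raddf0.
Qed.

Lemma count_lt (E : eqType) (a b : pred E) (s : seq E) x :
  subpred a b -> x \in s -> b x -> ~~ a x -> (count a s < count b s)%N.
Proof.
move=> ab xs bx /negbTE ax; have /permP ps := perm_to_rem xs.
by rewrite !ps /= bx ax add0n add1n ltnS; exact: sub_count.
Qed.

Lemma pathmod_empty_filt X (S : pathset I) :
  ~ (exists p, S p) -> filt X (pathfdm I_adm S).
Proof.
move=> nS; apply: filt_zero => x; apply: val_inj; apply: path_algP => p /=.
by rewrite path_coef0 (span_coef0 (pathmodP x)) //; apply/negP => Sp; apply: nS; exists p.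
Qed.

(** A shortest path [q] of [S] extends no other path of [S], so removing it leaves a submodule, with
    quotient the simple module at the end of [q]. Induction is on the number of paths. *)
Lemma pathset_filt (S : pathset I) i : (forall p, S p -> ptgt p <= i)%N ->
  filt (simples_le i) (pathfdm I_adm S).
Proof.
have [B uB memB] := good_finite I_adm.
elim: {S}_.+1 {-2}S (ltnSn (count S B)) => // m IH S ltm Si.
have [[p Sp]|nS] := pselect (exists p, S p); last first.
  exact: pathmod_empty_filt.
have [q [Sq minq]] : exists q, S q /\ forall r, S r ->
  (size (parrows q) <= size (parrows r))%N.
  pose P s := `[< exists2 r, S r & size (parrows r) = s >].
  have exP : exists s, P s by exists (size (parrows p)); apply/asboolP; exists p.
  case: (ex_minnP exP) => s /asboolP[q Sq <-] mins; exists q; split=> // r Sr.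
  by apply: mins; apply/asboolP; exists r.
have gS := pathset_subgood (T := S).
have c1 : convex (fun r => S r && (r != q)).
  move=> r1 r r2 /andP[S1 n1] /andP[S2 n2] p1 p2; rewrite (pathset_convex S1 S2 p1 p2).
  apply: contraNN n1 => /eqP e; rewrite e in p1; apply/eqP.
  by apply: pprefix_anti p1 _; exact: minq.
have c2 : convex (pred1 q).
  move=> r1 r r2 /eqP -> /eqP -> p1 p2; apply/eqP/esym.
  by apply: pprefix_anti p1 _; case/andP: p2 => _ /size_prefix.
pose S1 := goodset c1 (fun r h => gS r (proj1 (andP h))).
have g2 : subpred (pred1 q) good by move=> r /eqP ->; apply: (gS q Sq).
pose S2 := goodset c2 g2.
have [|r|r r' /andP[Sr nr] Sr' prr'|f [g fg]] := @path_ses _ _ _ _ I_adm S S1 S2.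
- move=> r /=; case: (r =P q) => [->|_]; first by rewrite Sq orbT.
  by rewrite andbT orbF.
- by rewrite /=; case: eqP; rewrite ?andbF.
- rewrite /= Sr' /=; apply: contraNN nr => /eqP e; rewrite e in prr'; apply/eqP.
  by apply: pprefix_anti prr' _; exact: minq.
apply: (filt_ext (F := simple (ptgt q)) fg).
- apply: IH => [|r /= /andP[/Si //]].
  rewrite -ltnS; apply: leq_trans ltm; rewrite ltnS; apply: (@count_lt _ _ _ _ q) => //=.
  + by move=> r /andP[].
  + by rewrite memB (gS q Sq).
  by rewrite eqxx andbF.
- by exists (ptgt q); first exact: Si.
suff pS : presents (pathelt S2 (of_path k q) : pathmod S2) (pred1 (ptrivial (ptgt q))).
  exact: (@presents_isomorphic _ _ _ _ (pathfdm I_adm S2) (simple _) _ _ _ pS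
    (simple_presents _)).
apply: (presents_eq (T := fun r => oapp S2 false (pconcat q r))) => [r|]; last first.
  by apply: pathmod_presents => [|r] /=; rewrite ?eqxx // => /eqP ->; exact: pprefix_refl.
case e: (pconcat q r) => [s|] /=.
  apply/eqP/eqP => [es|er].
    rewrite es in e; move/size_pconcat: (e) => /eqP;
      rewrite -{1}[size _]addn0 eqn_add2l eq_sym size_eq0.
    by case/pconcat_some: e => e _ _ /eqP er; apply: qpath_eq.
  by move: e; rewrite er pconcatp1 eqxx => -[].
by apply/esym/eqP => er; move: e; rewrite er pconcatp1 eqxx.
Qed.

(** Outside the standard basis, a path from [i] is in [I] or passes through a vertex [j] above [i];
    in the latter case its action factors through [M e_j], which vanishes. *)
Lemma std_ann (M : lmodType A^c) (z : M) i a : act z (e_ i) = z ->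
  (forall j, (i < j)%N -> forall x : M, act x (e_ j) = 0) ->
  (forall p, std_basis i p -> path_coef p a = 0) -> act z a = 0.
Proof.
move=> ze M0 h; rewrite -ze -actM.
have : e_ i * a \in span (fun p => ~~ std_basis i p && (psrc p == i)).
  apply: spanS (trivial_mul_span i a) => p /andP[sp]; rewrite sp andbT.
  by apply: contraNN => /h ->.
move: (e_ i * a); apply: span_ind => [|x y hx hy|c p /andP[nstd sp]].
- exact: act0r.
- by rewrite actDr hx hy addr0.
move: nstd; rewrite /std_basis sp /= negb_and => /orP[|nI]; last first.
  by apply/act_ideal/ideal_scale; rewrite -goodN.
case/allPn=> j /split_at_vertex[q [r [e qj]]]; rewrite -leqNgt => ij.
rewrite -(of_path_concat k e) -path_algZr -trivialMr qj -mulrA actM.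
by rewrite [act _ _]actM M0 // act0.
Qed.

Lemma std_presents_act0 (M : lmodType A^c) (y : M) i j : presents y (std_basis i) ->
  (i < j)%N -> forall x : M, act x (e_ j) = 0.
Proof.
move=> [gy ann] ij x; have [a ->] := gy x; rewrite -actM; apply/ann => p /and3P[_ wp _].
apply/eqP/contraT => /path_coefM_neq0[q [r [e _]]]; rewrite path_coefE.
case: (ptrivial j =P r) => [er|_]; last by rewrite eqxx.
move=> _; have := path_within_tgt wp; rewrite (ptgt_concat e) -er ltnS.
by rewrite leqNgt -[ptgt _]/j ij.
Qed.

Lemma stdmod_filt i : filt (simples_le i) (stdmod i).
Proof. by apply: pathset_filt => p /and3P[_ /path_within_tgt]; rewrite ltnS. Qed.

Lemma stdmod_maximal (P : fdm) (x : P) i : presents x (proj_basis i) ->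
  maximal_quotient (filt (simples_le i)) P (stdmod i).
Proof.
move=> px; split; first exact: stdmod_filt.
have [y py] := stdmod_presents i.
have xe := presents_act_trivial px (@proj_basis_src i).
have [f fx] : exists f : {linear P -> stdmod i}, f x = y.
  by apply: (presents_map px) => a h; apply/py.2 => p /std_basis_proj /h.
exists f; split=> [z|N g filtN epi_g].
  by have [a ->] := py.1 z; exists (act x a); rewrite linear_act fx.
have [h hy] : exists h : {linear stdmod i -> N}, h y = g x.
  apply: (presents_map py) => a; apply: std_ann; first by rewrite -linear_act xe.
  by move=> j ij; exact: simples_act0 filtN.
by exists h; apply: (presents_ext (f := h \o f) px); rewrite /= fx.
Qed.

(** The annihilator of the image of [x] in [D] is large enough because [D] has no part at vertices
    above [i], and not too large because [stdmod i] is a quotient of [D] by the universal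
    property. *)
Lemma maximal_quotient_presents (P D : fdm) (x : P) i : presents x (proj_basis i) ->
  maximal_quotient (filt (simples_le i)) P D -> exists y : D, presents y (std_basis i).
Proof.
move=> px [filtD [q [epi_q univ]]].
have xe := presents_act_trivial px (@proj_basis_src i).
have [_ [f [epi_f _]]] := stdmod_maximal px.
have [y0 py0] := stdmod_presents i.
have [g0 g0x] : exists g : {linear P -> stdmod i}, g x = y0.
  by apply: (presents_map px) => a h; apply/py0.2 => p /std_basis_proj /h.
have [|g gq] := univ _ g0 (stdmod_filt i).
  by move=> z; have [a ->] := py0.1 z; exists (act x a); rewrite linear_act g0x.
exists (q x); split=> [z|a].
  by have [w <-] := epi_q z; have [a ->] := px.1 w; exists a; rewrite linear_act.
split=> [e|]; last first.
  apply: std_ann; first by rewrite -linear_act xe.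
  by move=> j ij; exact: simples_act0 filtD.
by apply/py0.2; rewrite -g0x -gq -linear_act e raddf0.
Qed.

(** * Endomorphisms of the standard modules *)

Definition no_std_cycle i := forall p, std_basis i p -> ptgt p = i -> parrows p = [::].

(** Without cycles the trivial path is the only basis path that ends at [i], so the part of the
    module at [i] is spanned by [y]. *)
Lemma act_corner (M : lmodType A^c) (y : M) i a : presents y (std_basis i) ->
  no_std_cycle i ->
  act y (a * e_ i) = act y (path_alg_scalar Q (path_coef (ptrivial i) a)).
Proof.
move=> py cyc; apply/eqP; rewrite -subr_eq0 -actBr; apply/eqP/py.2 => p std_p.
rewrite path_coefB path_coefZ path_coef1; have sp := std_basis_src std_p.
have [tp|ntp] := eqVneq (ptgt p) i.
  have -> : p = ptrivial i by apply: qpath_eq; [|exact: cyc].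
  by rewrite path_coef_trivialM path_coefE !eqxx subrr.
have -> : path_coef p (a * e_ i) = 0.
  apply/eqP/contraT => /path_coefM_neq0[q [r [e _]]]; rewrite path_coefE.
  case: (ptrivial i =P r) => [er|_]; last by rewrite eqxx.
  by move/ptgt_concat: e ntp => ->; rewrite -er eqxx.
case: (parrows p =P [::]) => [ep|_]; last by rewrite mulr0 subrr.
by move: ntp; rewrite /ptgt ep /= sp eqxx.
Qed.

(** A cycle [c] in the basis gives the endomorphism that sends [y] to [y c], which is scalar only
    for trivial [c]. Conversely an endomorphism sends [y] into the part at [i], which is spanned by
    [y]. *)
Lemma std_end_scalar (D : fdm) (y : D) i : presents y (std_basis i) ->
  end_is_scalar D <-> no_std_cycle i.
Proof.
move=> py; have ye := presents_act_trivial py (@std_basis_src i).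
split=> [endD c std_c tc|cyc f].
  have [f fy] : exists f : {linear D -> D}, f y = act y (of_path k c).
    (* The map is well defined because [r] is in the basis whenever [c r] is. *)
    apply: (presents_map py) => a h; rewrite -actM; apply/py.2 => p std_p.
    apply/eqP/contraT => /path_coefM_neq0[q [r [e]]]; rewrite path_coefE.
    case: (c =P q) e => [<-|_]; last by rewrite eqxx.
    move=> e _; rewrite h ?eqxx //; case/and3P: std_p => _ wp gp.
    case/pconcat_some: (e) => er _ _.
    move: wp; rewrite (path_within_concat _ e) => /andP[_ wr].
    by rewrite /std_basis -er tc eqxx wr; case/andP: (good_concat e gp).
  have [l [fl _]] := endD f; have := fl y.
  rewrite fy -[ract _ _]/(act y (path_alg_scalar Q l)) => /eqP.
  rewrite -subr_eq0 -actBr => /eqP /(py.2 _).1 /(_ c std_c) /eqP.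
  rewrite path_coefB path_coefE eqxx path_coefZ path_coef1 subr_eq0.
  by have [//|_] := eqVneq (parrows c) [::]; rewrite mulr0 oner_eq0.
have [a ea] := py.1 (f y); pose l := path_coef (ptrivial i) a.
have fy : f y = act y (path_alg_scalar Q l).
  by rewrite -{1}ye linear_act ea -actM (act_corner a py cyc).
exists l; split=> [z|l' h].
  have [b ->] := py.1 z; rewrite linear_act fy.
  rewrite -[ract _ _]/(act _ (path_alg_scalar Q l)) -!actM; congr act.
  by rewrite /path_alg_scalar path_algZl path_algZr mul1r mulr1.
have := h y; rewrite fy -[ract _ _]/(act _ (path_alg_scalar Q l')) => /eqP.
rewrite -subr_eq0 -actBr => /eqP /(py.2 _).1 /(_ _ (std_basis_trivial i)) /eqP.
by rewrite path_coefB !path_coefZ path_coef_trivial1 !mulr1 subr_eq0 => /eqP.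
Qed.

(* This is M_{>j}. *)
Inductive trace (j : 'I_n) (M : lmodType A^c) : M -> Prop :=
| trace0 : trace j 0
| traceS l x a y : (j < l)%N -> trace j y -> trace j (y + act (act x (e_ l)) a).

Section TraceTheory.
Variables (j : 'I_n) (M : lmodType A^c).
Implicit Types x y : M.

Lemma traceD x y : trace j x -> trace j y -> trace j (x + y).
Proof.
move=> tx; elim=> [|l z a y' jl _ IH]; first by rewrite addr0.
by rewrite addrA; exact: traceS.
Qed.

Lemma trace_act x a : trace j x -> trace j (act x a).
Proof.
elim=> [|l z b y jl _ IH]; first by rewrite act0; exact: trace0.
by rewrite actDl -[act (act _ b) a]actM; exact: traceS.
Qed.

Lemma trace_gen l x a : (j < l)%N -> trace j (act (act x (e_ l)) a).
Proof. by move=> jl; rewrite -[act _ a]add0r; apply: traceS => //; exact: trace0. Qed.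

Lemma trace_eq0 x : (forall l, (j < l)%N -> forall y, act y (e_ l) = 0) ->
  trace j x -> x = 0.
Proof. by move=> M0; elim=> // l z a y jl _ ->; rewrite M0 // act0 addr0. Qed.

End TraceTheory.

Lemma traceB (M : lmodType A^c) j (x y : M) : trace j x -> trace j y -> trace j (x - y).
Proof.
move=> tx ty; apply: traceD => //; have := trace_act (-1) ty.
by rewrite -[-1]sub0r actBr act0r act1 sub0r.
Qed.

Lemma trace_linear (M N : lmodType A^c) j (f : {linear M -> N}) x :
  trace j x -> trace j (f x).
Proof.
elim=> [|l z a y jl _ IH]; first by rewrite raddf0; exact: trace0.
by rewrite raddfD /= !linear_act; exact: traceS.
Qed.

(** * Traces in an extension by a standard module *)

Section Extension.
Variables (L M N : fdm) (f : {linear L -> M}) (g : {linear M -> N}) (y : N) (l : 'I_n).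
Hypotheses (fg : short_exact f g) (py : presents y (std_basis l)).

Lemma std_lift : exists2 x0 : M, g x0 = y & act x0 (e_ l) = x0.
Proof.
case: fg => _ /(_ y)[x gx] _; exists (act x (e_ l)); last exact: act_trivialK.
by rewrite linear_act gx; exact: presents_act_trivial py (@std_basis_src l).
Qed.

Lemma std_lift_split (x0 x : M) : g x0 = y -> exists w a, x = f w + act x0 a.
Proof.
move=> gx0; have [a ga] := py.1 (g x); case: fg => _ _ ker.
have [w fw] : exists w, f w = x - act x0 a.
  by apply/ker; rewrite raddfB /= linear_act gx0 -ga subrr.
by exists w, a; rewrite fw subrK.
Qed.

(** A path from [l] that leaves the standard basis without being in [I] reaches some vertex [i]
    above [l]. Its segment up to [i] already moves [x0] into the image of [L] at [i], and such
    elements generate part of the trace since [j < l < i]. *)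
Lemma std_lift_trace j (x0 : M) a : (j < l)%N -> g x0 = y -> act x0 (e_ l) = x0 ->
  act y a = 0 -> exists2 w, trace j w & f w = act x0 a.
Proof.
move=> jl gx0 x0e /(py.2 _).1 h; case: fg => _ _ ker.
rewrite -x0e -actM.
have : e_ l * a \in span (fun p => ~~ std_basis l p && (psrc p == l)).
  apply: spanS (trivial_mul_span l a) => p /andP[sp]; rewrite sp andbT.
  by apply: contraNN => /h ->.
move: (e_ l * a); apply: span_ind => [|b c [w tw fw] [w' tw' fw']|c p /andP[nstd sp]].
- by exists 0; [exact: trace0|rewrite raddf0 act0r].
- by exists (w + w'); [exact: traceD|rewrite raddfD /= fw fw' actDr].
move: nstd; rewrite /std_basis sp /= negb_and => /orP[|nI]; last first.
  exists 0; first exact: trace0.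
  by rewrite raddf0 act_ideal //; apply/ideal_scale; rewrite -goodN.
case/allPn=> i /split_at_vertex[q [r [e qi]]]; rewrite -leqNgt => li.
have [w fw] : exists w, f w = act x0 (of_path k q).
  apply/ker; rewrite linear_act gx0; apply/py.2 => p' std_p'; rewrite path_coefE.
  case: (q =P p') => // eq; case/and3P: std_p' => _ /path_within_tgt.
  by rewrite -eq qi ltnS leqNgt li.
exists (act (act w (e_ i)) (c *: of_path k r)); first by apply: trace_gen;
  exact: ltn_trans li.
by rewrite !linear_act fw -!actM !mulrA -qi trivialMr path_algZr (of_path_concat k e).
Qed.

(* For [l > j] the reason is that the relations of Delta_l lift to L_{>j}. *)
Lemma trace_ses j w : trace j (f w) -> trace j w.
Proof.
case: (fg) => inj_f _ ker; have [lj|jl] := leqP l j.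
  (* For [l <= j] the module [N] has no part at vertices above [j], so all generators of the trace
     of [M] come from [L]. *)
  have lift z : trace j z -> exists2 w, trace j w & f w = z.
    elim=> [|i x a z' ji _ [w' tw' <-]]; first by exists 0; [exact: trace0|rewrite raddf0].
    have [u fu] : exists u, f u = act x (e_ i).
      by apply/ker; rewrite linear_act; apply: std_presents_act0 py _ _;
        exact: leq_ltn_trans ji.
    exists (w' + act (act u (e_ i)) a); first exact: traceS.
    by rewrite raddfD /= !linear_act fu act_trivialK.
  by move=> /lift[w' tw' /inj_f <-].
have [x0 gx0 x0e] := std_lift.
(* For [l > j] the trace of [M] lifts to the trace of [L] only up to multiples of [x0]. *)
have lift z : trace j z -> exists w a, trace j w /\ z = f w + act x0 a.
  elim=> [|i x a z' ji _ [w' [b [tw' ->]]]].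
    by exists 0, 0; split; [exact: trace0|rewrite raddf0 act0r addr0].
  have [u [c ->]] := std_lift_split x gx0.
  exists (w' + act (act u (e_ i)) a), (b + c * e_ i * a); split; first exact: traceS.
  by rewrite raddfD /= !linear_act actDr !actDl !actM addrACA.
move=> /lift[w' [a [tw' e]]].
(* The leftover multiple of [x0] comes from [L], hence is a relation of [y], and relations lift to
   the trace of [L]. *)
have fwa : f (w - w') = act x0 a by rewrite raddfB /= e addrC addKr.
have [w'' tw'' fw''] : exists2 w'', trace j w'' & f w'' = act x0 a.
  by apply: std_lift_trace => //; rewrite -gx0 -linear_act -fwa; apply/ker; exists (w - w').
by rewrite -(subrK w' w); apply: traceD => //; move: tw''; rewrite -fw'' in fwa;
  rewrite (inj_f _ _ fwa).
Qed.

End Extension.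

(** * Traces in modules filtered by standard modules *)

Section Filtered.
Variable X : fdm -> Prop.
Hypothesis X_std : forall F, X F ->
  exists l (y : F), presents y (std_basis l) /\ no_std_cycle l.

Lemma filt_std_trace (M : fdm) : filt X M -> forall j (x : M) r, act x (e_ j) = x ->
  std_basis j r -> trace j (act x (of_path k r)) -> trace j x.
Proof.
elim=> [M0 M00 j x r _ _ _|L M1 N F f g fg _ IH XF isoNF j x r xe std_r tr].
  by rewrite (M00 x); exact: trace0.
have [l [y' [py' cyc]]] := X_std XF; have [y py] := isomorphic_presents isoNF py'.
(* It suffices to write [x] as an element of [L] plus one of the trace: the induction hypothesis
   then applies to the part of [w] at [j]. *)
have lift w t : trace j t -> x = f w + t -> trace j x.
  move=> tt ex; rewrite -xe ex actDl; apply: traceD; last exact: trace_act.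
  rewrite -linear_act; apply: trace_linear; apply: (IH j _ r) => //;
    first exact: act_trivialK.
  apply: (trace_ses fg py); rewrite linear_act linear_act.
  have -> : act (f w) (e_ j) = x - act t (e_ j) by rewrite -{1}xe ex actDl addrK.
  by rewrite actBl; apply: traceB => //; do 2![apply: trace_act].
have [lj|jl] := leqP l j; last first.
  have [x0 gx0 x0e] := std_lift fg py.
  have [w [a ex]] := std_lift_split fg py x gx0.
  by apply: lift ex; rewrite -x0e; exact: trace_gen.
(* Here [l <= j], and [x] maps to zero in [N]. For [l < j] there is nothing at the vertex [j]; for
   [l = j] the image is a scalar multiple of [y], and the scalar is the coefficient at the basis
   path [r] of a relation. *)
have gx : g x = 0; last first.
  case: (fg) => _ _ /(_ x)[/(_ gx)[w fw] _].
  by apply: (lift w 0); [exact: trace0|rewrite addr0].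
have N0 i : (j < i)%N -> forall z : N, act z (e_ i) = 0.
  by move=> ji; apply: std_presents_act0 py _; exact: leq_ltn_trans ji.
have gr : act (g x) (of_path k r) = 0.
  by rewrite -linear_act; apply: trace_eq0 N0 _; exact: trace_linear.
move: lj; rewrite leq_eqVlt => /orP[/eqP/val_inj elj|lj]; last first.
  by rewrite -xe linear_act; exact: std_presents_act0 py _ _.
subst l.
have [b eb] := py.1 (g x).
have gx : g x = act y (path_alg_scalar Q (path_coef (ptrivial j) b)).
  by rewrite -(act_corner b py cyc) actM -eb -linear_act xe.
rewrite gx -actM in gr; have := (py.2 _).1 gr r std_r.
rewrite path_algZl mul1r path_coefZ path_coefE eqxx mulr1 => c0.
by rewrite gx c0 /path_alg_scalar scale0r act0r.
Qed.

End Filtered.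

(** Elements of the trace have representatives without any path that stays at or below [j], whereas
    [q] is such a path. *)
Lemma proj_trace (P : fdm) (x : P) i q : presents x (proj_basis i) -> proj_basis i q ->
  path_within (ptgt q).+1 q -> ~ trace (ptgt q) (act x (of_path k q)).
Proof.
move=> px pq wq; set j := ptgt q.
have tr z : trace j z -> exists2 a, z = act x a & forall p, path_within j.+1 p ->
  path_coef p a = 0.
  elim=> [|l y a z' jl _ [b -> hb]]; first by exists 0; [rewrite act0r|move=> p _;
    exact: path_coef0].
  have [c ->] := px.1 y; exists (b + c * e_ l * a); first by rewrite actDr !actM.
  move=> p wp; rewrite path_coefD hb // add0r; apply/eqP/contraT.
  move=> /path_coefM_neq0[s [t [e /path_coefM_neq0[s' [t' [e' _ h]]] _]]].
  move: h; rewrite path_coefE; case: (ptrivial l =P t') => [et|_]; last by rewrite eqxx.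
  move: wp; rewrite (path_within_concat _ e) => /andP[/path_within_tgt ws _].
  by move: ws; rewrite (ptgt_concat e') -et ltnS leqNgt -[ptgt _]/l jl.
move=> /tr[a ea h].
have : act x (of_path k q - a) = 0 by rewrite actBr ea subrr.
move/(px.2 _).1/(_ q pq)/eqP; rewrite path_coefB h // path_coefE eqxx subr0.
by rewrite oner_eq0.
Qed.

Lemma highest_weight_gluing : highest_weight (vertex_simple_mod I_adm) -> gluing I.
Proof.
case=> P [D [coverP maxD endD filtP]] q r s e gq gr ws.
have std l : exists y : D l, presents y (std_basis l).
  have [x px] := projective_cover_presents (coverP l).
  exact: maximal_quotient_presents px (maxD l).
pose i := psrc q; pose j := ptgt q.
have [x px] := projective_cover_presents (coverP i).
apply: contraT; rewrite goodN => sI; exfalso.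
have pq : proj_basis i q by rewrite /proj_basis eqxx.
move: (ws); rewrite (path_within_concat _ e) => /andP[wq wr].
(* If [q r] is in [I], then [x q r = 0] lies in the trace, and the filtration of [P i] forces [x q]
   into it as well. *)
apply: (proj_trace px pq wq).
apply: (filt_std_trace _ (filtP i) (r := r)).
- move=> F [l _ ->]; have [y py] := std l; exists l, y; split=> //.
  by apply/(std_end_scalar py); exact: endD.
- by rewrite -actM trivialMr.
- by rewrite /std_basis gr wr; case/pconcat_some: e => -> _ _; rewrite eqxx.
by rewrite -actM (of_path_concat k e) act_ideal //; exact: trace0.
Qed.

(* The top layer removed is spanned by the paths with the initial segment [q],
   where [q] has the lowest possible maximal vertex. *)
Lemma pathset_std_filt (S : pathset I) i : gluing I ->
  (forall p r, S p -> pprefix p r -> good r -> S r) ->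
  (forall p q, S p -> maxprefix q p -> S q) ->
  (forall p, S p -> psrc p = i) ->
  filt (fun M => exists2 j : 'I_n, (i <= j)%N & M = stdmod j) (pathfdm I_adm S).
Proof.
move=> glue; have acyc := gluing_acyclic I_adm glue.
have [B uB memB] := good_finite I_adm.
elim: {S}_.+1 {-2}S (ltnSn (count S B)) => // m IH S ltm Sr Smax Si.
have gS := pathset_subgood (T := S).
have [[p0 Sp0]|nS] := pselect (exists p, S p); last first.
  exact: pathmod_empty_filt.
pose top q := S q && path_within (ptgt q).+1 q.
have topE p q : S p -> maxprefix q p -> top q.
  move=> Sp mq; rewrite /top (Smax _ _ Sp mq); case/andP: mq => pq wp.
  exact: pprefix_within pq wp.
have [q [/andP[Sq wq] minq]] : exists q, top q /\ forall r, top r -> (ptgt q <= ptgt r)%N.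
  pose P v := `[< exists2 r, top r & ptgt r = v :> nat >].
  have exP : exists v, P v.
    have [q mq] := maxprefix_exists p0; exists (ptgt q).
    by apply/asboolP; exists q => //; exact: topE mq.
  case: (ex_minnP exP) => v /asboolP[q tq <-] minv; exists q; split=> // r tr.
  by apply: minv; apply/asboolP; exists r.
have max_of_within p q' : S p -> maxprefix q' p -> path_within (ptgt q).+1 p ->
  ptgt q' = ptgt q.
  move=> Sp mq' wp; apply/val_inj/eqP;
    rewrite eqn_leq (minq _ (topE _ _ Sp mq')) andbT -ltnS.
  by case/andP: mq' => pq' _; exact: path_within_tgt (pprefix_within pq' wp).
pose T1 p := S p && ~~ maxprefix q p; pose T2 p := S p && maxprefix q p.
(* If an extension [r] of [p] has the cut [q], then [p] stays at or below the end of [q]. By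
   minimality the cut of [p] ends at the same vertex, so it is also a cut of [r] and equals [q]. *)
have T1r p r : T1 p -> pprefix p r -> good r -> T1 r.
  move=> /andP[Sp nm] pr gr; rewrite /T1 (Sr _ _ Sp pr gr) /=.
  apply: contraNN nm => mr; have /andP[qr wr] := mr.
  have wp := pprefix_within pr wr.
  have [q' mq'] := maxprefix_exists p.
  have tq' := max_of_within _ _ Sp mq' wp.
  suff <- : q' = q by [].
  apply: (acyclic_maxprefix acyc gr _ mr); rewrite /maxprefix tq' wr andbT.
  by case/andP: mq' => pq' _; exact: pprefix_trans pr.
have c1 : convex T1.
  move=> p r s Tp /andP[Ss _] pr rs; apply: T1r pr _ => //.
  exact: good_pprefix rs (gS _ Ss).
have c2 : convex T2.
  move=> p r s /andP[Sp /andP[qp _]] /andP[Ss /andP[_ ws]] pr rs.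
  rewrite /T2 (Sr _ _ Sp pr (good_pprefix rs (gS _ Ss))) /maxprefix.
  by rewrite (pprefix_trans qp pr) (pprefix_within rs ws).
pose S1 := goodset c1 (fun r h => gS r (proj1 (andP h))).
pose S2 := goodset c2 (fun r h => gS r (proj1 (andP h))).
have [|p|p r T1p Sr' pr|f [g fg]] := @path_ses _ _ _ _ I_adm S S1 S2.
- by move=> p /=; rewrite /T1 /T2; case: (S p); case: (maxprefix q p).
- by rewrite /= /T1 /T2; case: (S p); case: (maxprefix q p).
- exact: T1r T1p pr (gS _ Sr').
have T2q : T2 q by rewrite /T2 Sq /maxprefix pprefix_refl wq.
apply: (filt_ext (F := stdmod (ptgt q)) fg).
- apply: IH => [|p r T1p pr gr|p q' /andP[Sp nm] mq'|p /andP[/Si //]].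
  + rewrite -ltnS; apply: leq_trans ltm; rewrite ltnS; apply: (@count_lt _ _ _ _ q) => //=.
    * by move=> r /andP[].
    * by rewrite memB (gS q Sq).
    by case/andP: T2q => _ mqq; rewrite /T1 mqq andbF.
  + exact: T1r T1p pr gr.
  + rewrite /= /T1 (Smax _ _ Sp mq') /=; apply: contraNN nm => mqq'.
    have := maxprefix_tgt mqq' (_ : maxprefix q' q'); rewrite /maxprefix pprefix_refl /=.
    case/andP: mq' => pq' wp /(_ (pprefix_within pq' wp)) ->.
    by rewrite wp andbT; case/andP: mqq' => qq' _; exact: pprefix_trans pq'.
- exists (ptgt q) => //; rewrite -ltnS -(Si _ Sq); exact: path_within_src.
suff pS : presents (pathelt S2 (of_path k q) : pathmod S2) (std_basis (ptgt q)).
  have [y py] := stdmod_presents (ptgt q).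
  exact: (@presents_isomorphic _ _ _ _ (pathfdm I_adm S2) (stdmod _) _ _ _ pS py).
apply: (presents_eq (T := fun r => oapp S2 false (pconcat q r))) => [r|]; last first.
  by apply: pathmod_presents => [|r] //= /andP[_ /andP[]].
case e: (pconcat q r) => [s|] /=; last first.
  apply/esym/negP => /std_basis_src sr; move: e; rewrite /pconcat.
  by case: eqP => // -[].
have [e1 _ _] := (pconcat_some _ _ _).1 e.
have qs : pprefix q s by apply/pprefixP; exists r.
rewrite /T2 /maxprefix qs (path_within_concat _ e) wq /= /std_basis -e1 eqxx /=.
have [wr|] := boolP (path_within _ r); last by rewrite andbF.
rewrite andbT; apply/idP/idP => [/gS /(good_concat e)/andP[] //|gr].
(* Gluing enters here: every basis path of the standard module at the end of [q] can follow [q], so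
   the layer is the whole standard module. *)
apply: (Sr _ _ Sq qs); apply: (glue _ _ _ e (gS _ Sq) gr).
by rewrite (path_within_concat _ e) wq wr.
Qed.

Lemma gluing_highest_weight : gluing I -> highest_weight (vertex_simple_mod I_adm).
Proof.
move=> glue; have acyc := gluing_acyclic I_adm glue.
exists (projmod), (stdmod); split=> i.
- have [x px] := projmod_presents i.
  exact (presents_projective_cover px).
- have [x px] := projmod_presents i.
  exact: stdmod_maximal px.
- have [y py] := stdmod_presents i.
  apply/(std_end_scalar py) => p /and3P[/eqP sp wp gp] tp.
  by apply: acyc; rewrite ?sp.
apply: pathset_std_filt => // [p r|p q|p] /andP[/eqP sp gp] //.
- by case/andP=> /eqP e _ gr; rewrite /= /proj_basis -e sp eqxx.
- case/andP=> pq _; rewrite /= /proj_basis (good_pprefix pq gp) andbT.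
  by case/andP: pq => /eqP ->; rewrite sp eqxx.
Qed.

End StandardModules.

Theorem corollary6p1 (k : closedFieldType) (n : nat) (Q : quiver n)
  (Q_loopless : forall a : arrow Q, src a <> tgt a)
  (I : ideal (path_alg k Q)) (I_adm : admissible I)
  (I_paths : generated_by_paths I) :
  let highest_weight_mod := highest_weight (vertex_simple_mod I_adm) in
  let path_count_formula :=
    (forall i : 'I_n, num_paths I i.+1 i i = 1%N) /\
    (forall i m : 'I_n,
       num_paths I n i m =
       (\sum_(j < n) num_paths I j.+1 i j * num_paths I j.+1 j m)%N) in
  let maximal_vertices_external :=
    forall p : qpath Q, minimal_path I p ->
    forall v : 'I_n, v \in internal p -> ~ maximal_vertex p v in
  (highest_weight_mod <-> path_count_formula) /\
  (path_count_formula <-> maximal_vertices_external).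
Proof.
have [B uB memB] := good_finite I_adm.
move=> hw cf ext.
have hwE : hw <-> gluing I.
  by split; [exact: highest_weight_gluing|exact: gluing_highest_weight].
have cfE : cf <-> gluing I.
  split=> [[_ h]|glue]; first exact: count_formula_gluing uB memB h.
  split=> [i|]; last exact: gluing_count_formula I_adm _ uB memB glue.
  exact: acyclic_count I_adm _ uB memB _ (gluing_acyclic I_adm glue).
have extE : ext <-> gluing I by split; [exact: external_gluing|exact: gluing_external].
by split; [rewrite hwE cfE|rewrite cfE extE].
Qed.
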